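(* Let $(M^n,g)$, $n\ge2$, be a smooth Riemannian manifold with scalar curvature $R$, let $p\in M$, and let $u_0,\dots,u_{n-2}$ be $C^3$ functions on $M$ with $du_0\wedge\cdots\wedge du_{n-2}\neq0$ at $p$. Let $Z_0,\dots,Z_{n-1}$ be nonvanishing smooth vector fields related by $Z_m|Z_{m+1}|^{-1}=\nabla_{\Sigma_m}u_m$ for $0\le m\le n-2$, and assume that at $p$ we have $\operatorname{div}_{\Sigma_m}Z_m=0$ for all $0\le m\le n-2$. Then at $p$, $$2|Z_0|^{-1}\Delta|Z_0|-2\Delta_{\Sigma_{n-1}}\log|Z_{n-1}|-2\sum_{m=0}^{n-2}|Z_m|^{-1}\nabla^{\Sigma_m}_{\nu_{m+1}}\bigl(\operatorname{div}_{\Sigma_m}Z_m\bigr)$$ $$=R+\sum_{m=0}^{n-2}|\nabla_{\Sigma_m}\nu_{m+1}|^2+|\nabla_{\Sigma_{n-1}}\log|Z_{n-1}||^2+|\nabla\log|Z_0||^2 .$$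
   Context: Near $p$, for $0\le m\le n-1$, $\Sigma_m$ denotes the joint level sets of the map $(u_0,\dots,u_{m-1})$, with $\Sigma_0=M$; through each point near $p$ passes exactly one such level set, locally an $(n-m)$-dimensional submanifold, with induced metric $g_{\Sigma_m}$ and Levi-Civita connection $\nabla^{\Sigma_m}$. $\nabla_{\Sigma_m}f$ and $\Delta_{\Sigma_m}f$ denote the gradient and Laplacian, at each point on the level set $\Sigma_m$ through it, of the restriction of $f$, and $\operatorname{div}_{\Sigma_m}$ the divergence on $\Sigma_m$ of a vector field tangent to the level sets $\Sigma_m$. Thus $\nabla_{\Sigma_m}u_m$ is the orthogonal projection of $\nabla u_m$ onto the orthogonal complement of $\nabla u_0,\dots,\nabla u_{m-1}$, and $\nu_{m+1}=\nabla_{\Sigma_m}u_m/|\nabla_{\Sigma_m}u_m|$ is the unit normal of $\Sigma_{m+1}\subset\Sigma_m$. $\nabla_{\Sigma_m}\nu_{m+1}$ is the full covariant derivative on $\Sigma_m$ of the vector field $\nu_{m+1}$ (including the direction $\nu_{m+1}$), and $\nabla^{\Sigma_m}_{\nu_{m+1}}f$ is the derivative of the function $f$ in direction $\nu_{m+1}$. $\nabla,\Delta$ without subscript are those of $(M,g)$. The field $Z_{n-1}$ enters only through its length $|Z_{n-1}|>0$. *)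

(* Defs.v *)
From HB Require Import structures.
From mathcomp Require Import all_boot all_order all_algebra.
From mathcomp Require Import all_classical all_reals all_analysis.

Set Implicit Arguments.
Unset Strict Implicit.
Unset Printing Implicit Defensive.

Import Order.TTheory GRing.Theory Num.Theory.
Import numFieldNormedType.Exports.

Local Open Scope classical_set_scope.
Local Open Scope ring_scope.

(** * Calculus on R^d *)

Definition partial (R : realType) (d : nat) (V : normedModType R)
    (i : 'I_d) (f : 'rV[R]_d -> V) (x : 'rV[R]_d) : V :=
  'D_(delta_mx 0 i) f x.

(** [f] is C^k on [A]; only used for open [A]. *)
Fixpoint Ck (R : realType) (d : nat) (V : normedModType R) (k : nat)
    (A : set 'rV[R]_d) (f : 'rV[R]_d -> V) : Prop :=
  (forall x, A x -> {for x, continuous f}) /\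
  match k with
  | 0%N => True
  | k'.+1 => forall i : 'I_d,
      (forall x, A x -> derivable f x (delta_mx 0 i)) /\ Ck k' A (partial i f)
  end.

Definition smooth (R : realType) (d : nat) (V : normedModType R)
    (A : set 'rV[R]_d) (f : 'rV[R]_d -> V) : Prop :=
  forall k, Ck k A f.

(** * Riemannian geometry in coordinates

    [G x] is the Gram matrix of the metric at the coordinate point [x]; a
    tangent vector is the row of its components; [invmx (G x) k l] is
    g^{kl}. *)

Definition inner (R : realType) (d : nat) (A : 'M[R]_d) (v w : 'rV[R]_d) : R :=
  (v *m A *m w^T) 0 0.

Definition vlength (R : realType) (d : nat) (A : 'M[R]_d) (v : 'rV[R]_d) : R :=
  Num.sqrt (inner A v v).

Section Coordinates.
Variables (R : realType) (d : nat) (G : 'rV[R]_d -> 'M[R]_d).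
Implicit Types (x : 'rV[R]_d) (f : 'rV[R]_d -> R) (Y : 'rV[R]_d -> 'rV[R]_d).

Definition metric_inv x : 'M[R]_d := invmx (G x).

(** Gamma^k_{ij} of the Levi-Civita connection *)
Definition christoffel (k i j : 'I_d) x : R :=
  2^-1 * \sum_(l < d) metric_inv x k l *
    (partial i (fun y => G y j l) x + partial j (fun y => G y i l) x
     - partial l (fun y => G y i j) x).

Definition gradient f x : 'rV[R]_d :=
  \row_k \sum_(l < d) metric_inv x k l * partial l f x.

(** the covariant derivative of [Y] along the [i]-th coordinate field *)
Definition covariant Y (i : 'I_d) x : 'rV[R]_d :=
  \row_k (partial i (fun y => Y y 0 k) x
          + \sum_(j < d) christoffel k i j x * Y x 0 j).

Definition divergence Y x : R := \sum_(i < d) covariant Y i x 0 i.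

Definition laplacian f x : R := divergence (gradient f) x.

Definition covariant_sqnorm Y x : R :=
  \sum_(i < d) \sum_(j < d)
    metric_inv x i j * inner (G x) (covariant Y i x) (covariant Y j x).

(** the [l]-th component of Rm(d_i, d_j) d_k *)
Definition riemann (l k i j : 'I_d) x : R :=
  partial i (christoffel l j k) x - partial j (christoffel l i k) x
  + \sum_(m < d) (christoffel l i m x * christoffel m j k x
                  - christoffel l j m x * christoffel m i k x).

Definition ricci (j k : 'I_d) x : R := \sum_(i < d) riemann i k i j x.

Definition scalar_curvature x : R :=
  \sum_(j < d) \sum_(k < d) metric_inv x j k * ricci j k x.

End Coordinates.

(** * Manifolds *)

(** [co] and [par] carry no information outside [dom] and [co @` dom]. *)
Record chart (R : realType) (M : Type) (d : nat) := Chart {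
  dom : set M;
  co : M -> 'rV[R]_d;
  par : 'rV[R]_d -> M
}.

(** [s] is a homeomorphism from a relatively open subset of [S] onto an open
    subset of R^d, with inverse [par s]. *)
Definition is_chart (R : realType) (M : topologicalType) (d : nat)
    (S : set M) (s : chart R M d) : Prop :=
  [/\ exists2 W : set M, open W & dom s = S `&` W,
      open (co s @` dom s),
      {within dom s, continuous (co s)},
      forall y, (co s @` dom s) y -> {for y, continuous (par s)}
    & forall q, dom s q -> par s (co s q) = q].

Record smoothManifold (R : realType) (n : nat) := SmoothManifold {
  carrier :> topologicalType;
  manifold_hausdorff : hausdorff_space carrier;
  manifold_countable : @second_countable carrier;
  atlas : set (chart R carrier n);
  atlas_chart : forall c, atlas c -> is_chart setT c;
  atlas_cover : forall q, exists2 c, atlas c & dom c q;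
  atlas_compatible : forall c c', atlas c -> atlas c' ->
    smooth (co c @` (dom c `&` dom c')) (co c' \o par c)
}.

Section OnManifold.
Variables (R : realType) (n : nat) (M : smoothManifold R n).

Definition CkOn (k : nat) (U : set M) (f : M -> R) : Prop :=
  forall c, atlas c -> Ck k (co c @` (dom c `&` U)) (f \o par c).

(** With the row convention of ['J], a vector with components [v] in [c] has
    components [v *m transition c c' q] in [c']. *)
Definition transition (c c' : chart R M n) (q : M) : 'M[R]_n :=
  'J (co c' \o par c) (co c q).

Record riemannianMetric := RiemannianMetric {
  gram :> chart R M n -> M -> 'M[R]_n;
  gram_sym : forall c q, atlas c -> dom c q -> (gram c q)^T = gram c q;
  gram_pos : forall c q v, atlas c -> dom c q -> v != 0 ->
    0 < inner (gram c q) v v;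
  gram_smooth : forall c, atlas c -> smooth (co c @` dom c) (gram c \o par c);
  gram_transition : forall c c' q, atlas c -> atlas c' -> dom c q ->
    dom c' q ->
    gram c q = transition c c' q *m gram c' q *m (transition c c' q)^T
}.

(** Smooth vector fields on [U], given by their components in each chart. *)
Record vectorField (U : set M) := VectorField {
  components :> chart R M n -> M -> 'rV[R]_n;
  components_smooth : forall c, atlas c ->
    smooth (co c @` (dom c `&` U)) (components c \o par c);
  components_transition : forall c c' q, atlas c -> atlas c' -> U q -> dom c q ->
    dom c' q -> components c' q = components c q *m transition c c' q
}.

Definition differential (c : chart R M n) (f : M -> R) (q : M) : 'rV[R]_n :=
  \row_i partial i (f \o par c) (co c q).

Definition pairing (a v : 'rV[R]_n) : R := (v *m a^T) 0 0.

Definition wedge (k : nat) (a : nat -> 'rV[R]_n) (v : 'I_k -> 'rV[R]_n) : R :=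
  \det (\matrix_(i < k, j < k) pairing (a i) (v j)).

Variables (g : riemannianMetric) (u : nat -> M -> R).

(** The joint level set of (u_0, ..., u_{m-1}) through [q]. *)
Definition level (m : nat) (q : M) : set M :=
  [set q' | forall i, (i < m)%N -> u i q' = u i q].

Definition level_tangent (c : chart R M n) (m : nat) (q : M) (v : 'rV[R]_n)
    : Prop :=
  forall i, (i < m)%N -> pairing (differential c (u i) q) v = 0.

(** [v] is the gradient at [q] of the restriction of [f] to [level m q]. *)
Definition is_level_gradient (c : chart R M n) (m : nat) (f : M -> R) (q : M)
    (v : 'rV[R]_n) : Prop :=
  level_tangent c m q v /\
  forall w, level_tangent c m q w ->
    inner (g c q) v w = pairing (differential c f q) w.

Section Submanifold.
Variables (d : nat) (c : chart R M n) (s : chart R M d).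

(** Row [a] holds the components in [c] of the [a]-th coordinate field of
    [s]. *)
Definition frame (y : 'rV[R]_d) : 'M[R]_(d, n) := 'J (co c \o par s) y.

Definition induced_metric (y : 'rV[R]_d) : 'M[R]_d :=
  frame y *m g c (par s y) *m (frame y)^T.

(** The components in [s] of a vector field tangent to the submanifold:
    [tangent_comp Z y *m frame y = Z c (par s y)]. *)
Definition tangent_comp (Z : chart R M n -> M -> 'rV[R]_n) (y : 'rV[R]_d)
    : 'rV[R]_d :=
  Z c (par s y) *m pinvmx (frame y).

Definition unit_gradient (f : M -> R) (y : 'rV[R]_d) : 'rV[R]_d :=
  let v := gradient induced_metric (f \o par s) in
  (vlength (induced_metric y) (v y))^-1 *: v y.

End Submanifold.

(** [s] is a chart of the C^k submanifold [S] of [M]. *)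
Definition submanifold_chart (k : nat) (S : set M) (d : nat)
    (s : chart R M d) : Prop :=
  is_chart S s /\
  forall c, atlas c ->
    Ck k (co s @` (dom s `&` dom c)) (co c \o par s) /\
    forall q, dom s q -> dom c q -> row_free (frame c s (co s q)).

Definition field_length (U : set M) (c : chart R M n) (Z : vectorField U)
    (q : M) : R :=
  vlength (g c q) (Z c q).

End OnManifold.

(* Main.v *)
Require Import Defs.
From HB Require Import structures.
From mathcomp Require Import all_boot all_order all_algebra.
From mathcomp Require Import all_classical all_reals all_analysis.
From mathcomp Require Import ring lra.

Set Implicit Arguments.
Unset Strict Implicit.
Unset Printing Implicit Defensive.

Import Order.TTheory GRing.Theory Num.Theory.
Import numFieldNormedType.Exports.

Local Open Scope classical_set_scope.
Local Open Scope ring_scope.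

(** Near p, put e_m = Z_m / |Z_m| for m <= n-2 (the unit normal nu_{m+1} of
    the statement) and complete these vectors by a unit vector e_{n-1} to a
    frame. This frame is orthonormal, and e_m, ..., e_{n-1} are tangent to the
    level sets Sigma_m, for every m at once ([level_frame_exists]). The
    identity is proved by computing everything in this single ambient frame:
    the intrinsic quantities of Sigma_m are sums of the coefficients
    Gamma_ijk = <nabla_{e_i} e_j, e_k> over indices that are at least m, and no
    curvature of an intermediate Sigma_m occurs. Write f_m = log |Z_m|.

    (1) Let D_i = div e_i. Bochner's formula for Ric(e_i, e_i), summed over the
    frame, gives R = - 2 sum_i e_i(D_i) - sum_i D_i^2 - Q, where Q is the sum of
    the products Gamma_ijk Gamma_kji ([bochner], [scalar_curvature_frame]).

    (2) For i, j > k the bracket of e_i and e_j is tangent to the level sets of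
    u_k, so Gamma_ijk = Gamma_jik ([conn_flag]). Therefore the mixed terms of Q
    cancel, and Q is the sum of the |nabla_{Sigma_m} nu_{m+1}|^2
    ([flag_connection_trace], [covariant_sqnorm_unit]).

    (3) The relation between the fields Z_m says that
    e_m(u_m) = |Z_m| / |Z_{m+1}|. Applying the bracket of e_m and e_j to u_m
    yields Gamma_mmj = e_j(f_m - f_{m+1}) for j > m ([conn_shape]). The
    difference between D_m and the divergence of e_m on Sigma_m is a sum of
    such terms, which telescopes: D_m = K_m - e_m(f_0), where
    K_m = e_m(f_m) + div_{Sigma_m} e_m is the divergence of Z_m on Sigma_m
    divided by |Z_m| ([frame_div_level], [divergence_weighted]).

    (4) At p, K_m = 0 for m <= n-2, while Sigma_{n-1} is a curve, so that
    K_{n-1} = e_{n-1}(f_{n-1}) and e_{n-1}(K_{n-1}) is the Laplacian of f_{n-1}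
    on it ([laplacian_curve]). Substituting (3) into (1), and into the Laplacian
    of |Z_0| written in the frame, gives the identity ([frame_identity]).

    The charts of the Sigma_m enter through Gauss's formula
    ([tangential_nabla]): the covariant derivative of an induced metric is the
    tangential part of the ambient one. The calculus behind all this consists
    of the chain rule for C^1 maps and of the symmetry of second derivatives
    ([C1_differentiable], [partialC]). *)

(** * Functions of class C^k *)

Section CkCalculus.
Variables (R : realType) (d : nat).
Implicit Types (A B : set 'rV[R]_d) (x : 'rV[R]_d) (i : 'I_d).

Lemma near_open A x : open A -> A x -> \forall z \near x, A z.
Proof. by move=> oA Ax; exact: open_nbhs_nbhs. Qed.

Lemma near_partial (V : normedModType R) (f g : 'rV[R]_d -> V) i x :
  (\near x, f x = g x) -> partial i f x = partial i g x.
Proof. exact: near_eq_derive. Qed.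

Lemma partial_eq_on (V : normedModType R) A (f g : 'rV[R]_d -> V) i x :
  open A -> (forall y, A y -> f y = g y) -> A x ->
  partial i f x = partial i g x.
Proof.
move=> oA fg Ax; apply: near_partial; near=> z; apply: fg.
by near: z; exact: near_open.
Unshelve. all: by end_near. Qed.

Lemma derivable_eq_on (V : normedModType R) A (f g : 'rV[R]_d -> V) v x :
  open A -> (forall y, A y -> f y = g y) -> A x ->
  derivable f x v -> derivable g x v.
Proof.
move=> oA fg Ax; apply: near_eq_derivable; near=> z; apply: fg.
by near: z; exact: near_open.
Unshelve. all: by end_near. Qed.

Lemma continuous_eq_on (V : normedModType R) A (f g : 'rV[R]_d -> V) x :
  open A -> (forall y, A y -> f y = g y) -> A x ->
  {for x, continuous f} -> {for x, continuous g}.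
Proof.
move=> oA fg Ax; rewrite /prop_for /continuous_at -(fg _ Ax) => cf.
suff E : {near x, f =1 g} by apply: cvg_trans cf; exact: near_eq_cvg E.
by near=> z; apply: fg; near: z; exact: near_open.
Unshelve. all: by end_near. Qed.

Lemma Ck_subset (V : normedModType R) k A B (f : 'rV[R]_d -> V) :
  B `<=` A -> Ck k A f -> Ck k B f.
Proof.
move=> BA; elim: k f => [|k IH] f /= [cf df]; split=> //.
- by move=> x /BA; exact: cf.
- by move=> x /BA; exact: cf.
by move=> i; have [di ci] := df i; split=> [x /BA|]; [exact: di|exact: IH].
Qed.

Lemma Ck_eq_on (V : normedModType R) k A (f g : 'rV[R]_d -> V) :
  open A -> (forall x, A x -> f x = g x) -> Ck k A f -> Ck k A g.
Proof.
move=> oA; elim: k f g => [|k IH] f g fg /= [cf df].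
  by split=> // x Ax; apply: (continuous_eq_on oA fg) => //; exact: cf.
split=> [x Ax|i].
  by apply: (continuous_eq_on oA fg) => //; exact: cf.
have [di ci] := df i; split=> [x Ax|].
  by apply: (derivable_eq_on oA fg) => //; exact: di.
by apply: IH ci => x Ax; exact: (partial_eq_on _ oA fg).
Qed.

Lemma Ck_continuous (V : normedModType R) k A (f : 'rV[R]_d -> V) x :
  Ck k A f -> A x -> {for x, continuous f}.
Proof. by case: k => [|k] [cf _]; exact: cf. Qed.

Lemma Ck_derivable (V : normedModType R) k A (f : 'rV[R]_d -> V) x i :
  Ck k.+1 A f -> A x -> derivable f x (delta_mx 0 i).
Proof. by move=> [_ df]; have [di _] := df i; exact: di. Qed.

Lemma Ck_partial (V : normedModType R) k A (f : 'rV[R]_d -> V) i :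
  Ck k.+1 A f -> Ck k A (partial i f).
Proof. by move=> [_ df]; have [] := df i. Qed.

Lemma Ck_leS (V : normedModType R) k A (f : 'rV[R]_d -> V) :
  Ck k.+1 A f -> Ck k A f.
Proof.
elim: k f => [|k IH] f [cf df]; first by split.
by split=> // i; have [di ci] := df i; split=> //; exact: IH.
Qed.

Lemma Ck_le (V : normedModType R) k l A (f : 'rV[R]_d -> V) :
  (l <= k)%N -> Ck k A f -> Ck l A f.
Proof.
elim: k => [|k IH]; first by rewrite leqn0 => /eqP->.
by rewrite leq_eqVlt => /orP[/eqP->//|lk /Ck_leS]; exact: IH.
Qed.

Section Values.
Implicit Types (f g : 'rV[R]_d -> R).

Lemma partialD f g i x :
  derivable f x (delta_mx 0 i) -> derivable g x (delta_mx 0 i) ->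
  partial i (fun y => f y + g y) x = partial i f x + partial i g x.
Proof. exact: deriveD. Qed.

Lemma partialN f i x : derivable f x (delta_mx 0 i) ->
  partial i (fun y => - f y) x = - partial i f x.
Proof. exact: deriveN. Qed.

Lemma partialB f g i x :
  derivable f x (delta_mx 0 i) -> derivable g x (delta_mx 0 i) ->
  partial i (fun y => f y - g y) x = partial i f x - partial i g x.
Proof. exact: deriveB. Qed.

Lemma partialM f g i x :
  derivable f x (delta_mx 0 i) -> derivable g x (delta_mx 0 i) ->
  partial i (fun y => f y * g y) x = partial i f x * g x + f x * partial i g x.
Proof.
move=> df dg; rewrite [LHS](deriveM df dg) addrC.
by congr (_ + _); rewrite [LHS]mulrC.
Qed.

Lemma partial_cst (a : R) i x : partial i (fun _ => a) x = 0.
Proof. exact: derive_cst. Qed.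

Lemma derivable_bigsum (I : Type) (r : seq I) (P : pred I)
    (F : I -> 'rV[R]_d -> R) x v :
  (forall j, P j -> derivable (F j) x v) ->
  derivable (fun y => \sum_(j <- r | P j) F j y) x v.
Proof.
move=> dF; elim: r => [|a r IH].
  apply: near_eq_derivable (derivable_cst (0 : R) x v).
  by near=> z; rewrite big_nil.
case: (boolP (P a)) => Pa.
  apply: near_eq_derivable (derivableD (dF _ Pa) IH).
  by near=> z; rewrite big_cons Pa.
apply: near_eq_derivable IH.
by near=> z; rewrite big_cons (negPf Pa).
Unshelve. all: by end_near. Qed.

Lemma partial_bigsum (I : Type) (r : seq I) (P : pred I)
    (F : I -> 'rV[R]_d -> R) i x :
  (forall j, P j -> derivable (F j) x (delta_mx 0 i)) ->
  partial i (fun y => \sum_(j <- r | P j) F j y) x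
  = \sum_(j <- r | P j) partial i (F j) x.
Proof.
move=> dF; elim: r => [|a r IH].
  rewrite big_nil -[RHS](partial_cst (0 : R) i x); apply: near_partial.
  by near=> z; rewrite big_nil.
rewrite big_cons -IH; case: ifPn => Pa; last first.
  by apply: near_partial; near=> z; rewrite big_cons (negPf Pa).
rewrite -partialD; last 2 first.
- exact: dF.
- exact: derivable_bigsum.
by apply: near_partial; near=> z; rewrite big_cons Pa.
Unshelve. all: by end_near. Qed.

Lemma Ck_cst k A (a : R) : Ck k A (fun _ => a).
Proof.
elim: k a => [|k IH] a; split=> //; try by move=> x _; exact: (@cst_continuous _ _ a).
move=> i; split; first by move=> x _; exact: derivable_cst.
have -> : partial i (fun _ : 'rV[R]_d => a) = (fun=> 0 : R).
  by apply/funext => z; exact: partial_cst.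
exact: IH.
Qed.

Variables (A : set 'rV[R]_d).
Hypothesis oA : open A.

Lemma CkD k f g : Ck k A f -> Ck k A g -> Ck k A (fun x => f x + g x).
Proof.
elim: k f g => [|k IH] f g [cf df] [cg dg]; split=> //;
  try by move=> x Ax; apply: (@continuousD _ _ _ f g); [exact: cf|exact: cg].
move=> i; have [dfi cfi] := df i; have [dgi cgi] := dg i; split=> [x Ax|].
  by apply: derivableD; [exact: dfi|exact: dgi].
apply: Ck_eq_on (IH _ _ cfi cgi) => // x Ax.
by rewrite partialD //; [exact: dfi|exact: dgi].
Qed.

Lemma CkM k f g : Ck k A f -> Ck k A g -> Ck k A (fun x => f x * g x).
Proof.
elim: k f g => [|k IH] f g.
  by move=> [cf _] [cg _]; split=> // x Ax; apply: (@continuousM _ _ f g);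
    [exact: cf|exact: cg].
move=> Cf Cg; move: (Ck_leS Cf) (Ck_leS Cg) => Cf' Cg'.
move: Cf Cg => [cf df] [cg dg]; split.
  by move=> x Ax; apply: (@continuousM _ _ f g); [exact: cf|exact: cg].
move=> i; have [dfi cfi] := df i; have [dgi cgi] := dg i; split=> [x Ax|].
  by apply: derivableM; [exact: dfi|exact: dgi].
apply: Ck_eq_on (CkD (IH _ _ cfi Cg') (IH _ _ Cf' cgi)) => // x Ax.
by rewrite partialM //; [exact: dfi|exact: dgi].
Qed.

Lemma CkN k f : Ck k A f -> Ck k A (fun x => - f x).
Proof.
move=> Cf; apply: Ck_eq_on (CkM (Ck_cst k A (-1)) Cf) => // x _.
by rewrite mulN1r.
Qed.

Lemma CkB k f g : Ck k A f -> Ck k A g -> Ck k A (fun x => f x - g x).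
Proof. by move=> Cf Cg; apply: CkD => //; exact: CkN. Qed.

Lemma Ck_sum k (I : Type) (r : seq I) (P : pred I) (F : I -> 'rV[R]_d -> R) :
  (forall j, P j -> Ck k A (F j)) -> Ck k A (fun x => \sum_(j <- r | P j) F j x).
Proof.
move=> CF; elim: r => [|a r IH].
  by apply: Ck_eq_on (Ck_cst k A 0) => // x _; rewrite big_nil.
case: (boolP (P a)) => Pa.
  apply: Ck_eq_on (CkD (CF _ Pa) IH) => // x _.
  by rewrite big_cons Pa.
by apply: Ck_eq_on IH => // x _; rewrite big_cons (negPf Pa).
Qed.

Lemma Ck_prod k (I : Type) (r : seq I) (P : pred I) (F : I -> 'rV[R]_d -> R) :
  (forall j, P j -> Ck k A (F j)) -> Ck k A (fun x => \prod_(j <- r | P j) F j x).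
Proof.
move=> CF; elim: r => [|a r IH].
  by apply: Ck_eq_on (Ck_cst k A 1) => // x _; rewrite big_nil.
case: (boolP (P a)) => Pa.
  apply: Ck_eq_on (CkM (CF _ Pa) IH) => // x _.
  by rewrite big_cons Pa.
by apply: Ck_eq_on IH => // x _; rewrite big_cons (negPf Pa).
Qed.

Lemma derive_along_line f x v :
  'D_1 (fun h : R => f (h *: v + x)) 0 = 'D_v f x.
Proof.
rewrite /derive (_ : (fun h : R => h^-1 *: _) = (fun h : R => h^-1 *: (f (h *: v + x) - f x))) //.
by apply/funext => h /=; rewrite addr0 scale0r add0r [_%:A]mulr1.
Qed.

(** Restricted to the line through x in direction v, this is the
    one-variable chain rule. *)
Lemma is_derive_comp1 (phi : R -> R) (a : R) f x v :
  is_derive (f x) 1 phi a -> derivable f x v ->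
  is_derive x v (fun y => phi (f y)) (a * 'D_v f x).
Proof.
move=> dphi df.
have df1 : is_derive (0 : R) 1 (fun h : R => f (h *: v + x)) ('D_v f x).
  split; first by move/(derivable1P f x v): df.
  exact: derive_along_line.
have dphi' : is_derive (f (0 *: v + x)) 1 phi a by rewrite scale0r add0r.
have [d1 d2] := @is_derive1_comp _ phi _ 0 _ _ dphi' df1.
split; first by apply/(derivable1P (fun y => phi (f y)) x v).
rewrite -d2; apply/esym.
exact: (derive_along_line (fun y => phi (f y))).
Qed.

(** The derivative of 1/f is a product of 1/f, taken twice, and a
    derivative of f; this is why the induction on k closes, here and for
    the square root. *)
Lemma Ck_inv k f : (forall x, A x -> f x != 0) -> Ck k A f ->
  Ck k A (fun x => (f x)^-1).
Proof.
move=> f0; elim: k => [|k IH].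
  by move=> [cf _]; split=> // x Ax; apply: continuousV; [exact: f0|exact: cf].
move=> Cf; have IH' := IH (Ck_leS Cf); move: Cf => [cf df]; split.
  by move=> x Ax; apply: continuousV; [exact: f0|exact: cf].
move=> i; have [dfi cfi] := df i; split=> [x Ax|].
  by apply: derivableV; [exact: f0|exact: dfi].
apply: Ck_eq_on (CkN (CkM (CkM IH' IH') cfi)) => // x Ax.
rewrite [RHS](deriveV (f0 _ Ax) (dfi _ Ax)) -mulNr; congr (_ * _).
by rewrite -invfM -expr2.
Qed.

Lemma Ck_sqrt k f : (forall x, A x -> 0 < f x) -> Ck k A f ->
  Ck k A (fun x => Num.sqrt (f x)).
Proof.
move=> f0; elim: k => [|k IH].
  move=> [cf _]; split=> // x Ax.
  by apply: continuous_comp; [exact: cf|exact: sqrt_continuous].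
move=> Cf; have IH' := IH (Ck_leS Cf); move: Cf => [cf df]; split.
  by move=> x Ax; apply: continuous_comp; [exact: cf|exact: sqrt_continuous].
move=> i; have [dfi cfi] := df i.
have dd x : A x -> is_derive x (delta_mx 0 i) (fun y => Num.sqrt (f y))
    ((2 * Num.sqrt (f x))^-1 * partial i f x).
  move=> Ax; apply: is_derive_comp1; last exact: dfi.
  exact/is_derive1_sqrt/f0.
split=> [x /dd[]//|].
have Ci : Ck k A (fun x => (2 * Num.sqrt (f x))^-1).
  apply: Ck_inv; last by apply: CkM => //; exact: Ck_cst.
  by move=> x Ax; rewrite mulf_neq0 // sqrtr_eq0 -ltNge f0.
by apply: Ck_eq_on (CkM Ci cfi) => // x /dd[].
Qed.

Lemma partial_ln f i x : 0 < f x -> derivable f x (delta_mx 0 i) ->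
  is_derive x (delta_mx 0 i) (fun y => ln (f y)) ((f x)^-1 * partial i f x).
Proof.
by move=> f0 df; apply: is_derive_comp1 => //; exact: is_derive1_ln.
Qed.

Lemma Ck_ln k f : (forall x, A x -> 0 < f x) -> Ck k A f ->
  Ck k A (fun x => ln (f x)).
Proof.
move=> f0; case: k => [|k].
  move=> [cf _]; split=> // x Ax.
  by apply: continuous_comp; [exact: cf|exact/continuous_ln/f0].
move=> Cf; have Cf' := Ck_leS Cf; move: Cf => [cf df]; split.
  move=> x Ax.
  by apply: continuous_comp; [exact: cf|exact/continuous_ln/f0].
move=> i; have [dfi cfi] := df i.
have dd x : A x -> is_derive x (delta_mx 0 i) (fun y => ln (f y))
    ((f x)^-1 * partial i f x).
  by move=> Ax; apply: partial_ln; [exact: f0|exact: dfi].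
split=> [x /dd[]//|].
apply: Ck_eq_on (CkM (Ck_inv _ Cf') cfi) => //.
  by move=> x /dd[].
by move=> x /f0; rewrite lt0r => /andP[].
Qed.

End Values.

Lemma Ck_coord k (m n : nat) A (F : 'rV[R]_d -> 'M[R]_(m, n)) a b :
  open A -> Ck k A F -> Ck k A (fun x => F x a b).
Proof.
move=> oA; elim: k F => [|k IH] F [cF dF]; split=> //;
  try by move=> x Ax; apply: (@continuous_comp _ _ _ F (fun M : 'M[R]_(m, n) => M a b));
    [exact: cF|exact: coord_continuous].
move=> i; have [dFi cFi] := dF i; split=> [x Ax|].
  exact: ((derivable_mxP _ _ _).1 (dFi _ Ax)).
apply: Ck_eq_on (IH _ cFi) => // x Ax.
by rewrite [in LHS]/partial derive_mx ?mxE //; exact: dFi.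
Qed.

End CkCalculus.

(** * Differentiability and symmetry of second derivatives *)

Section Differentiability.
Variables (R : realType) (d : nat).
Implicit Types (A B : set 'rV[R]_d) (x z h : 'rV[R]_d) (i j : 'I_d)
  (f : 'rV[R]_d -> R).

Lemma is_derive_line f z v (s : R) : derivable f (s *: v + z) v ->
  is_derive s 1 (fun t : R => f (t *: v + z)) ('D_v f (s *: v + z)).
Proof.
have E : (fun h : R => h^-1 *: (((fun t : R => f (t *: v + z)) \o shift s) (h *: 1)
            - f (s *: v + z))) =
         (fun h : R => h^-1 *: ((f \o shift (s *: v + z)) (h *: v) - f (s *: v + z))).
  apply/funext => h /=; congr (_ *: (f _ - _)).
  by rewrite [_%:A]mulr1 scalerDl addrA.
by move=> df; split; rewrite /derivable /derive E.
Qed.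

(** The parameter t may be negative or zero, so that t can be any
    coordinate of an increment. *)
Lemma MVT_line f i z (t : R) :
  (forall s : R, `|s| <= `|t| -> derivable f (s *: delta_mx 0 i + z) (delta_mx 0 i)) ->
  exists2 s : R, `|s| <= `|t| &
    f (t *: delta_mx 0 i + z) - f z = t * partial i f (s *: delta_mx 0 i + z).
Proof.
move=> df; pose g (s : R) := f (s *: delta_mx 0 i + z).
have dg (s : R) : `|s| <= `|t| ->
    is_derive s 1 g (partial i f (s *: delta_mx 0 i + z)).
  by move=> st; apply: is_derive_line; exact: df.
have g0 : g 0 = f z by rewrite /g scale0r add0r.
have [t0|t0|t0] := ltgtP 0 t; last first.
- by exists 0; rewrite ?normr0 // -t0 scale0r add0r subrr mul0r.
- have bnd (s : R) : s \in `[t, 0]%R -> `|s| <= `|t|.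
    by rewrite in_itv /= => /andP[ts s0]; rewrite !ler0_norm ?lerN2 // ltW.
  have sub (s : R) : s \in `]t, 0[%R -> s \in `[t, 0]%R by exact: subset_itv_oo_cc.
  have [] := @MVT R g _ t 0 t0 (fun s sI => dg s (bnd s (sub s sI))).
    by apply: derivable_within_continuous => s /bnd/dg[].
  move=> c /sub/bnd ct E; exists c => //.
  by move: E; rewrite g0 sub0r /g => E; rewrite -opprB E mulrN opprK mulrC.
- have bnd (s : R) : s \in `[0, t]%R -> `|s| <= `|t|.
    by rewrite in_itv /= => /andP[ts s0]; rewrite !ger0_norm // ltW.
  have sub (s : R) : s \in `]0, t[%R -> s \in `[0, t]%R by exact: subset_itv_oo_cc.
  have [] := @MVT R g _ 0 t t0 (fun s sI => dg s (bnd s (sub s sI))).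
    by apply: derivable_within_continuous => s /bnd/dg[].
  move=> c /sub/bnd ct E; exists c => //.
  by move: E; rewrite g0 subr0 /g => ->; rewrite mulrC.
Qed.

Lemma rV_norm_coord (v : 'rV[R]_d) i : `|v 0 i| <= `|v|.
Proof.
rewrite [leRHS]/Num.Def.normr/= mx_normrE.
exact: (le_bigmax _ (fun k : 'I_1 * 'I_d => `|v k.1 k.2|) (0, i)).
Qed.

Lemma rV_norm_le (v : 'rV[R]_d) (r : R) : 0 <= r ->
  (forall i, `|v 0 i| <= r) -> `|v| <= r.
Proof.
move=> r0 vr; rewrite [leLHS]/Num.Def.normr/= mx_normrE bigmax_le //.
by move=> [a b] _ /=; rewrite ord1.
Qed.

Lemma near_norm (P : set 'rV[R]_d) x : (\forall z \near x, P z) ->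
  exists2 r : R, 0 < r & forall h, `|h| < r -> P (h + x).
Proof.
move=> /nbhs_normP[r /= r0 rP]; exists r => // h hr.
by apply: rP; rewrite /= opprD addrCA subrr addr0 normrN.
Qed.

(** The increment f(x + h) - f(x) is split along the broken line that
    switches on the coordinates of h one at a time. The mean value theorem
    on each segment turns it into partial derivatives at points near x,
    which are close to the partial derivatives at x by continuity. *)
Lemma C1_differentiable A f x : open A -> Ck 1 A f -> A x -> differentiable f x.
Proof.
move=> oA Cf Ax; pose c i := partial i f x.
pose L h := \sum_i h 0 i * c i.
have Llin : linear L.
  move=> a u v; rewrite /L scaler_sumr -big_split; apply: eq_bigr => i _.
  by rewrite /= !mxE mulrDl -mulrA.
pose LM := GRing.isLinear.Build _ _ _ _ _ Llin.
pose LL : {linear 'rV[R]_d -> R} := HB.pack L LM.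
have Lcont : continuous LL.
  move=> v; apply: (@Ck_continuous _ _ _ 0 setT L v) => //.
  apply: Ck_sum => [|i _]; first exact: openT.
  apply: CkM; [exact: openT| |exact: Ck_cst].
  by split=> // z _; exact: coord_continuous.
suff E : f \o shift x = cst (f x) + LL +o_ (0 : 'rV[R]_d) id.
  by apply/diff_locallyP; rewrite (diff_unique Lcont E).
apply/eqaddoP => _/posnumP[e].
have e'0 : 0 < e%:num / d.+1%:R by rewrite divr_gt0.
have [r r0 rP] : exists2 r : R, 0 < r & forall h, `|h| < r ->
    A (h + x) /\ forall i, `|partial i f (h + x) - c i| <= e%:num / d.+1%:R.
  apply: (near_norm (P := fun z => A z /\
    forall i, `|partial i f z - c i| <= e%:num / d.+1%:R)).
  near=> z; split; first by near: z; exact: near_open.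
  near: z; apply: filter_forall => i.
  have := Ck_continuous (Ck_partial i Cf) Ax.
  move/cvgrPdist_le => /(_ _ e'0); apply: filterS => z.
  by rewrite distrC.
have nr : \forall h \near (0 : 'rV[R]_d), `|h| < r by exact: nbhs0_lt.
near=> h.
have hr : `|h| < r.
  by near: h; exact: nr.
(* The vertices of the broken line from 0 to h. *)
pose hk k : 'rV[R]_d := \row_j (if (j < k)%N then h 0 j else 0).
have hk0 : hk 0%N = 0 by apply/rowP => j; rewrite !mxE.
have hkd : hk d = h by apply/rowP => j; rewrite !mxE ltn_ord.
have hkS (k : 'I_d) : hk k.+1 = h 0 k *: delta_mx 0 k + hk k.
  apply/rowP => j; rewrite !mxE eqxx /= ltnS leq_eqVlt.
  have [<-|ne] := eqVneq j k; first by rewrite eqxx ltnn mulr1 addr0.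
  by rewrite (negPf (_ : (j : nat) != k)) //= mulr0 add0r.
have bnd (k : 'I_d) s : `|s| <= `|h 0 k| -> `|s *: delta_mx 0 k + hk k| <= `|h|.
  move=> sh; apply: rV_norm_le => // j; rewrite !mxE eqxx /=.
  have [->|ne] := eqVneq j k.
    by rewrite ltnn mulr1 addr0 (le_trans sh) // rV_norm_coord.
  rewrite mulr0 add0r; case: ifP => _; first exact: rV_norm_coord.
  by rewrite normr0.
have step (k : 'I_d) :
    `|f (hk k.+1 + x) - f (hk k + x) - h 0 k * c k| <= `|h| * (e%:num / d.+1%:R).
  have -> : hk k.+1 + x = h 0 k *: delta_mx 0 k + (hk k + x).
    by rewrite hkS addrA.
  have [|s sh ->] := @MVT_line f k (hk k + x) (h 0 k).
    move=> s sh; rewrite addrA; apply: Ck_derivable Cf _.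
    by have [] := rP _ (le_lt_trans (bnd _ _ sh) hr).
  rewrite -mulrBr normrM ler_pM // ?rV_norm_coord // addrA.
  by have [] := rP _ (le_lt_trans (bnd _ _ sh) hr).
suff : `|f (h + x) - f x - L h| <= e%:num * `|h| by rewrite -addrA -opprD.
have -> : f (h + x) - f x = \sum_(k < d) (f (hk k.+1 + x) - f (hk k + x)).
  rewrite -(big_mkord xpredT (fun k => f (hk k.+1 + x) - f (hk k + x))).
  by rewrite (telescope_sumr (fun k => f (hk k + x))) // hk0 hkd add0r.
rewrite /L -sumrB (le_trans (ler_norm_sum _ _ _)) //.
apply: (le_trans (ler_sum _ (fun k _ => step k))).
rewrite sumr_const card_ord -[leLHS]mulr_natr [leRHS]mulrC -mulrA.
by rewrite ler_wpM2l // mulrAC ler_pdivrMr // ler_wpM2l // ler_nat.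
Unshelve. all: by end_near. Qed.

(** The second difference of f over a square of side t, evaluated by two
    mean values. The left-hand side is symmetric in the two directions and
    the right-hand side is not, which is what [partialC] exploits. *)
Lemma second_difference A f i j x (t : R) : 0 < t -> Ck 2 A f ->
  (forall h, `|h| <= t -> A (h + x)) ->
  i != j ->
  exists2 h, `|h| <= t &
    f (t *: delta_mx 0 i + (t *: delta_mx 0 j + x)) - f (t *: delta_mx 0 i + x)
    - (f (t *: delta_mx 0 j + x) - f x)
    = t * (t * partial j (partial i f) (h + x)).
Proof.
move=> t0 Cf At ij.
have bnd (a b : R) : `|a| <= t -> `|b| <= t ->
    `|a *: delta_mx 0 i + b *: delta_mx 0 j : 'rV[R]_d| <= t.
  move=> at_ bt; apply: rV_norm_le; first exact: ltW.
  move=> k; rewrite !mxE eqxx /=.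
  have [->|_] := eqVneq k i; first by rewrite (negPf ij) mulr1 mulr0 addr0.
  by rewrite mulr0 add0r; case: eqVneq => _; rewrite ?mulr1 ?mulr0 ?normr0 // ltW.
have tt : `|t| <= t by rewrite gtr0_norm.
have z0 : `|0 : R| <= t by rewrite normr0 ltW.
(* The second difference is the increment along i of the increment g of f
   along j. *)
pose g y := f (t *: delta_mx 0 j + y) - f y.
have A1 (s : R) : `|s| <= t -> A (s *: delta_mx 0 i + (t *: delta_mx 0 j + x)).
  by move=> st; rewrite addrA; apply/At/bnd.
have A2 (s : R) : `|s| <= t -> A (s *: delta_mx 0 i + x).
  by move=> st; apply: At; have := bnd _ _ st z0; rewrite scale0r addr0.
have dg (s : R) : `|s| <= `|t| ->
   derivable g (s *: delta_mx 0 i + x) (delta_mx 0 i) /\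
   partial i g (s *: delta_mx 0 i + x) =
     partial i f (s *: delta_mx 0 i + (t *: delta_mx 0 j + x))
     - partial i f (s *: delta_mx 0 i + x).
  rewrite (gtr0_norm t0) => st.
  have E : (fun h : R => h^-1 *: (((fun y => f (t *: delta_mx 0 j + y))
       \o shift (s *: delta_mx 0 i + x)) (h *: delta_mx 0 i)
     - f (t *: delta_mx 0 j + (s *: delta_mx 0 i + x)))) =
    (fun h : R => h^-1 *: ((f \o shift (s *: delta_mx 0 i + (t *: delta_mx 0 j + x)))
     (h *: delta_mx 0 i) - f (s *: delta_mx 0 i + (t *: delta_mx 0 j + x)))).
    apply/funext => h /=; congr (_ *: (f _ - f _)); last exact: addrCA.
    by rewrite addrCA; congr (_ + _); exact: addrCA.
  have d1 : derivable (fun y => f (t *: delta_mx 0 j + y)) (s *: delta_mx 0 i + x)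
      (delta_mx 0 i).
    by rewrite /derivable E; apply: Ck_derivable Cf _; exact: A1.
  have d2 : derivable f (s *: delta_mx 0 i + x) (delta_mx 0 i).
    by apply: Ck_derivable Cf _; exact: A2.
  split; first exact: derivableB.
  rewrite [LHS](partialB d1 d2); congr (_ - _).
  by rewrite /partial /derive E.
have [s st /= E] := MVT_line (fun s st => (dg s st).1).
rewrite (dg _ st).2 in E; rewrite (gtr0_norm t0) in st.
have dpi (s' : R) : `|s'| <= `|t| -> derivable (partial i f)
    (s' *: delta_mx 0 j + (s *: delta_mx 0 i + x)) (delta_mx 0 j).
  rewrite (gtr0_norm t0) => st'; apply: Ck_derivable (Ck_partial i Cf) _.
  by rewrite addrCA addrA; apply/At/bnd.
have [s' st' E'] := MVT_line dpi.
rewrite (gtr0_norm t0) in st'.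
exists (s *: delta_mx 0 i + s' *: delta_mx 0 j); first exact: bnd.
have -> : s *: delta_mx 0 i + s' *: delta_mx 0 j + x
    = s' *: delta_mx 0 j + (s *: delta_mx 0 i + x).
  by rewrite -addrA addrCA.
rewrite -E'.
have -> : partial i f (t *: delta_mx 0 j + (s *: delta_mx 0 i + x))
    = partial i f (s *: delta_mx 0 i + (t *: delta_mx 0 j + x)).
  by congr (partial i f); exact: addrCA.
rewrite -E /g.
have -> : f (t *: delta_mx 0 j + (t *: delta_mx 0 i + x))
    = f (t *: delta_mx 0 i + (t *: delta_mx 0 j + x)).
  by congr f; exact: addrCA.
by [].
Qed.

Lemma near_continuous2 A (F G : 'rV[R]_d -> R) x (e : R) :
  open A -> A x -> 0 < e ->
  {for x, continuous F} -> {for x, continuous G} ->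
  exists2 r : R, 0 < r & forall h, `|h| < r ->
    [/\ A (h + x), `|F x - F (h + x)| <= e & `|G x - G (h + x)| <= e].
Proof.
move=> oA Ax e0 /cvgrPdist_le/(_ _ e0) n1 /cvgrPdist_le/(_ _ e0) n2.
apply: (near_norm (P := fun z => [/\ A z, `|F x - F z| <= e & `|G x - G z| <= e])).
have nA := near_open oA Ax.
by apply: filterS3 nA n1 n2 => z; split.
Qed.

(** Schwarz's theorem. The symmetry of the second fundamental forms, the
    action of brackets on functions and the curvature identity all rest on
    it. *)
Lemma partialC A f i j x : open A -> Ck 2 A f -> A x ->
  partial i (partial j f) x = partial j (partial i f) x.
Proof.
move=> oA Cf Ax; have [->//|ij] := eqVneq i j.
have close (a b c c' e : R) : c = c' -> `|a - c'| <= e / 2 ->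
    `|b - c| <= e / 2 -> `|a - b| <= 0 + e.
  move=> ->; rewrite add0r !ler_norml => /andP[a1 a2] /andP[b1 b2].
  by apply/andP; split; lra.
apply/eqP; rewrite -subr_eq0 -normr_le0; apply/ler_addgt0Pr => e e0.
have e20 : 0 < e / 2 by rewrite divr_gt0.
have [r r0 rP] := near_continuous2 oA Ax e20
  (Ck_continuous (Ck_partial i (Ck_partial j Cf)) Ax)
  (Ck_continuous (Ck_partial j (Ck_partial i Cf)) Ax).
have t0 : 0 < r / 2 by rewrite divr_gt0.
have tr h : `|h| <= r / 2 -> `|h| < r.
  by move=> hr; apply: (le_lt_trans hr); rewrite ltr_pdivrMr // ltr_pMr // ltr1n.
have At h : `|h| <= r / 2 -> A (h + x) by move=> /tr/rP[].
have [h1 /tr/rP[_ _ h1P] E1] := second_difference t0 Cf At ij.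
have ji : j != i by rewrite eq_sym.
have [h2 /tr/rP[_ h2P _] E2] := second_difference t0 Cf At ji.
have E : partial j (partial i f) (h1 + x) = partial i (partial j f) (h2 + x).
  have swap (b a' b' c : R) :
      c - b - (a' - b') = c - a' - (b - b') by ring.
  have cancel (t a b : R) : 0 < t -> t * (t * a) = t * (t * b) -> a = b.
    by move=> /lt0r_neq0 t1 /(mulfI t1)/(mulfI t1).
  apply: (cancel _ _ _ t0); apply: (etrans (esym E1)); apply: (etrans _ E2).
  have -> : f (r / 2 *: delta_mx 0 j + (r / 2 *: delta_mx 0 i + x))
      = f (r / 2 *: delta_mx 0 i + (r / 2 *: delta_mx 0 j + x)).
    by congr f; exact: addrCA.
  exact: swap.
exact: close E h2P h1P.
Qed.

Lemma derive_partial f x v : differentiable f x ->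
  'D_v f x = \sum_i v 0 i * partial i f x.
Proof.
move=> df; rewrite (deriveE _ df) {1}(row_sum_delta v) linear_sum.
by apply: eq_bigr => i _; rewrite linearZ /= /partial (deriveE _ df).
Qed.

End Differentiability.

Section ChainRule.
Variables (R : realType) (d n : nat).
Variables (B : set 'rV[R]_d) (Phi : 'rV[R]_d -> 'rV[R]_n).
Hypotheses (oB : open B) (CPhi : Ck 1 B Phi).

Lemma C1_row_differentiable y : B y -> differentiable Phi y.
Proof.
move=> By.
have -> : Phi = \sum_(k < n) (fun z => Phi z 0 k *: (delta_mx 0 k : 'rV[R]_n)).
  by apply/funext => z; rewrite fct_sumE; exact: row_sum_delta.
apply: differentiable_sum => k; apply: differentiableZl.
exact: (C1_differentiable oB (Ck_coord 0 k oB CPhi) By).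
Qed.

(** The Jacobian is defined through the differential, so its entries are
    known to be partial derivatives only where the map is differentiable. *)
Lemma jacobianE y a k : B y -> 'J Phi y a k = partial a (fun z => Phi z 0 k) y.
Proof.
move=> By; have dP := C1_row_differentiable By.
rewrite /jacobian mxE -(deriveE _ dP) derive_mx ?mxE //.
exact: diff_derivable.
Qed.

Lemma partial_comp (A : set 'rV[R]_n) (f : 'rV[R]_n -> R) y a :
  open A -> Ck 1 A f -> B y -> A (Phi y) ->
  differentiable (f \o Phi) y /\
  partial a (f \o Phi) y = \sum_k 'J Phi y a k * partial k f (Phi y).
Proof.
move=> oA Cf By Ay; have dP := C1_row_differentiable By.
have df := C1_differentiable oA Cf Ay.
have dc : differentiable (f \o Phi) y by exact: differentiable_comp.
split=> //; rewrite /partial (deriveE _ dc) (diff_comp dP df) /=.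
rewrite -(deriveE _ df) (derive_partial _ df).
by apply: eq_bigr => k _; rewrite /jacobian [in RHS]mxE.
Qed.

End ChainRule.

(** * Matrix-valued functions and directional derivatives *)

Section MatrixCalculus.
Variables (R : realType) (d : nat).
Implicit Types (A : set 'rV[R]_d) (x : 'rV[R]_d) (i : 'I_d).

(** Regularity is required entry by entry, so that closure under matrix
    products reduces to scalar functions. *)
Definition mxCk (k p q : nat) A (M : 'rV[R]_d -> 'M[R]_(p, q)) : Prop :=
  forall a b, Ck k A (fun y => M y a b).

Definition mpartial (p q : nat) i (M : 'rV[R]_d -> 'M[R]_(p, q)) x : 'M[R]_(p, q) :=
  \matrix_(a, b) partial i (fun y => M y a b) x.

(** The derivative of f along v, defined as a sum over the coordinates so
    that it is linear in v whether or not f is differentiable. *)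
Definition dir (v : 'rV[R]_d) (f : 'rV[R]_d -> R) x : R :=
  \sum_i v 0 i * partial i f x.

Variables (A : set 'rV[R]_d).
Hypothesis oA : open A.

Lemma mxCk_le k l p q (M : 'rV[R]_d -> 'M[R]_(p, q)) :
  (l <= k)%N -> mxCk k A M -> mxCk l A M.
Proof. by move=> lk CM a b; exact: Ck_le (CM a b). Qed.

Lemma mxCk_eq_on k p q (M N : 'rV[R]_d -> 'M[R]_(p, q)) :
  (forall z, A z -> M z = N z) -> mxCk k A M -> mxCk k A N.
Proof.
by move=> MN CM a b; apply: (Ck_eq_on oA) (CM a b) => z Az; rewrite MN.
Qed.

Lemma mxCk_mul k p q r (M : 'rV[R]_d -> 'M[R]_(p, q))
    (N : 'rV[R]_d -> 'M[R]_(q, r)) :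
  mxCk k A M -> mxCk k A N -> mxCk k A (fun y => M y *m N y).
Proof.
move=> CM CN a b.
have C : Ck k A (fun y => \sum_j M y a j * N y j b).
  by apply: (Ck_sum oA) => j _; apply: (CkM oA); [exact: CM|exact: CN].
by apply: (Ck_eq_on oA) C => y _; rewrite mxE.
Qed.

Lemma mxCk_tr k p q (M : 'rV[R]_d -> 'M[R]_(p, q)) :
  mxCk k A M -> mxCk k A (fun y => (M y)^T).
Proof.
by move=> CM a b; apply: (Ck_eq_on oA) (CM b a) => y _; rewrite mxE.
Qed.

Lemma mxCk_scale k p q (f : 'rV[R]_d -> R) (M : 'rV[R]_d -> 'M[R]_(p, q)) :
  Ck k A f -> mxCk k A M -> mxCk k A (fun y => f y *: M y).
Proof.
move=> Cf CM a b; apply: (Ck_eq_on oA) (CkM oA Cf (CM a b)) => y _.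
by rewrite mxE.
Qed.

Lemma mxCk_add k p q (M N : 'rV[R]_d -> 'M[R]_(p, q)) :
  mxCk k A M -> mxCk k A N -> mxCk k A (fun y => M y + N y).
Proof.
move=> CM CN a b; apply: (Ck_eq_on oA) (CkD oA (CM a b) (CN a b)) => y _.
by rewrite mxE.
Qed.

Lemma mxCk_opp k p q (M : 'rV[R]_d -> 'M[R]_(p, q)) :
  mxCk k A M -> mxCk k A (fun y => - M y).
Proof.
move=> CM a b; apply: (Ck_eq_on oA) (CkN oA (CM a b)) => y _.
by rewrite mxE.
Qed.

Lemma mxCk_cst k p q (M : 'M[R]_(p, q)) : mxCk k A (fun=> M).
Proof. by move=> a b; exact: Ck_cst. Qed.

Lemma mxCk_sum k p q (I : Type) (r : seq I) (P : pred I)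
    (M : I -> 'rV[R]_d -> 'M[R]_(p, q)) :
  (forall j, P j -> mxCk k A (M j)) ->
  mxCk k A (fun y => \sum_(j <- r | P j) M j y).
Proof.
move=> CM a b.
have C : Ck k A (fun y => \sum_(j <- r | P j) M j y a b).
  by apply: (Ck_sum oA) => j Pj; exact: CM.
by apply: (Ck_eq_on oA) C => y _; rewrite summxE.
Qed.

Lemma mxCk_partial k p q i (M : 'rV[R]_d -> 'M[R]_(p, q)) :
  mxCk k.+1 A M -> mxCk k A (mpartial i M).
Proof.
move=> CM a b; apply: (Ck_eq_on oA) (Ck_partial i (CM a b)) => y _.
by rewrite mxE.
Qed.

Lemma Ck_det k p (M : 'rV[R]_d -> 'M[R]_p) :
  mxCk k A M -> Ck k A (fun y => \det (M y)).
Proof.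
move=> CM; rewrite /determinant.
apply: (Ck_sum oA) => s _; apply: (CkM oA); first exact: Ck_cst.
by apply: (Ck_prod oA) => j _; exact: CM.
Qed.

(** By Cramer's rule the entries of the inverse are cofactors divided by
    the determinant. *)
Lemma mxCk_inv k p (M : 'rV[R]_d -> 'M[R]_p) :
  (forall y, A y -> M y \in unitmx) ->
  mxCk k A M -> mxCk k A (fun y => invmx (M y)).
Proof.
move=> Mu CM a b.
have C : Ck k A (fun y => (\det (M y))^-1 * ((-1) ^+ (b + a)
   * \det (row' b (col' a (M y))))).
  apply: (CkM oA).
    apply: (Ck_inv oA); last exact: Ck_det.
    by move=> y /Mu; rewrite unitmxE unitfE.
  apply: (CkM oA); first exact: Ck_cst.
  apply: Ck_det => a' b'; apply: (Ck_eq_on oA) (CM (lift b a') (lift a b')) => y _.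
  by rewrite !mxE.
by apply: (Ck_eq_on oA) C => y /Mu My; rewrite /invmx My !mxE.
Qed.

Lemma mpartial_eq_on p q i (M N : 'rV[R]_d -> 'M[R]_(p, q)) x :
  (forall z, A z -> M z = N z) -> A x -> mpartial i M x = mpartial i N x.
Proof.
move=> MN Ax; apply/matrixP => a b; rewrite !mxE.
by apply: (partial_eq_on _ oA) => // z Az; rewrite MN.
Qed.

Lemma mpartialM p q r i (M : 'rV[R]_d -> 'M[R]_(p, q))
    (N : 'rV[R]_d -> 'M[R]_(q, r)) x :
  mxCk 1 A M -> mxCk 1 A N -> A x ->
  mpartial i (fun y => M y *m N y) x = mpartial i M x *m N x + M x *m mpartial i N x.
Proof.
move=> CM CN Ax; apply/matrixP => a b; rewrite !mxE.
have dM j : derivable (fun y => M y a j) x (delta_mx 0 i) :=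
  Ck_derivable (CM a j) Ax.
have dN j : derivable (fun y => N y j b) x (delta_mx 0 i) :=
  Ck_derivable (CN j b) Ax.
transitivity (partial i (fun y => \sum_j M y a j * N y j b) x).
  by apply: near_partial; near=> y; rewrite mxE.
rewrite partial_bigsum => [|j _]; last by apply: derivableM.
rewrite -big_split; apply: eq_bigr => j _.
by rewrite /= partialM // !mxE.
Unshelve. all: by end_near. Qed.

Lemma mpartial_tr p q i (M : 'rV[R]_d -> 'M[R]_(p, q)) x :
  mpartial i (fun y => (M y)^T) x = (mpartial i M x)^T.
Proof.
apply/matrixP => a b; rewrite !mxE; apply: near_partial.
by near=> y; rewrite mxE.
Unshelve. all: by end_near. Qed.

Lemma mpartialD p q i (M N : 'rV[R]_d -> 'M[R]_(p, q)) x :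
  mxCk 1 A M -> mxCk 1 A N -> A x ->
  mpartial i (fun y => M y + N y) x = mpartial i M x + mpartial i N x.
Proof.
move=> CM CN Ax; apply/matrixP => a b; rewrite !mxE.
rewrite -partialD; last 2 first.
- exact: Ck_derivable (CM a b) Ax.
- exact: Ck_derivable (CN a b) Ax.
by apply: near_partial; near=> y; rewrite mxE.
Unshelve. all: by end_near. Qed.

Lemma mpartialZ p q i (f : 'rV[R]_d -> R) (M : 'rV[R]_d -> 'M[R]_(p, q)) x :
  Ck 1 A f -> mxCk 1 A M -> A x ->
  mpartial i (fun y => f y *: M y) x = partial i f x *: M x + f x *: mpartial i M x.
Proof.
move=> Cf CM Ax; apply/matrixP => a b; rewrite !mxE.
rewrite -partialM; last 2 first.
- exact: Ck_derivable Cf Ax.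
- exact: Ck_derivable (CM a b) Ax.
by apply: near_partial; near=> y; rewrite mxE.
Unshelve. all: by end_near. Qed.

Lemma mpartial_sum p q i (I : Type) (r : seq I) (P : pred I)
    (M : I -> 'rV[R]_d -> 'M[R]_(p, q)) x :
  (forall j, P j -> mxCk 1 A (M j)) -> A x ->
  mpartial i (fun y => \sum_(j <- r | P j) M j y) x
  = \sum_(j <- r | P j) mpartial i (M j) x.
Proof.
move=> CM Ax; apply/matrixP => a b; rewrite !mxE summxE.
transitivity (partial i (fun y => \sum_(j <- r | P j) M j y a b) x).
  by apply: near_partial; near=> y; rewrite summxE.
rewrite partial_bigsum => [|j Pj]; last exact: Ck_derivable (CM _ Pj a b) Ax.
by apply: eq_bigr => j _; rewrite mxE.
Unshelve. all: by end_near. Qed.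

Lemma mpartialC p q i j (M : 'rV[R]_d -> 'M[R]_(p, q)) x :
  mxCk 2 A M -> A x ->
  mpartial i (mpartial j M) x = mpartial j (mpartial i M) x.
Proof.
move=> CM Ax; apply/matrixP => a b; rewrite [LHS]mxE [RHS]mxE.
have E k l : partial k (fun y => mpartial l M y a b) x
    = partial k (partial l (fun y => M y a b)) x.
  by apply: near_partial; near=> y; rewrite mxE.
apply: (etrans (E i j)); apply: (etrans _ (esym (E j i))).
exact: (partialC _ _ oA (CM a b) Ax).
Unshelve. all: by end_near. Qed.

Implicit Types (f g : 'rV[R]_d -> R).

Lemma Ck_dir k (v : 'rV[R]_d -> 'rV[R]_d) f :
  mxCk k A v -> Ck k.+1 A f -> Ck k A (fun y => dir (v y) f y).
Proof.
move=> Cv Cf; apply: (Ck_sum oA) => i _; apply: (CkM oA); first exact: Cv.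
exact: Ck_partial Cf.
Qed.

Lemma dir_eq_on v f g x : (forall y, A y -> f y = g y) -> A x ->
  dir v f x = dir v g x.
Proof.
move=> fg Ax; apply: eq_bigr => i _; congr (_ * _).
exact: (partial_eq_on _ oA fg Ax).
Qed.

Lemma dirD v f g x : Ck 1 A f -> Ck 1 A g -> A x ->
  dir v (fun y => f y + g y) x = dir v f x + dir v g x.
Proof.
move=> Cf Cg Ax; rewrite /dir -big_split; apply: eq_bigr => i _ /=.
have df := Ck_derivable (i := i) Cf Ax; have dg := Ck_derivable (i := i) Cg Ax.
by rewrite (partialD df dg) mulrDr.
Qed.

Lemma dirM v f g x : Ck 1 A f -> Ck 1 A g -> A x ->
  dir v (fun y => f y * g y) x = dir v f x * g x + f x * dir v g x.
Proof.
move=> Cf Cg Ax; rewrite /dir mulr_suml mulr_sumr -big_split.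
apply: eq_bigr => i _ /=.
have df := Ck_derivable (i := i) Cf Ax; have dg := Ck_derivable (i := i) Cg Ax.
by rewrite (partialM df dg) mulrDr mulrA [in RHS]mulrCA.
Qed.

Lemma dirN v f x : Ck 1 A f -> A x ->
  dir v (fun y => - f y) x = - dir v f x.
Proof.
move=> Cf Ax; rewrite /dir -sumrN; apply: eq_bigr => i _ /=.
by rewrite (partialN (Ck_derivable (i := i) Cf Ax)) mulrN.
Qed.

Lemma dirB v f g x : Ck 1 A f -> Ck 1 A g -> A x ->
  dir v (fun y => f y - g y) x = dir v f x - dir v g x.
Proof.
move=> Cf Cg Ax; apply: (etrans (dirD _ Cf (CkN oA Cg) Ax)).
by congr (_ + _); exact: (dirN _ Cg Ax).
Qed.

Lemma dir_cst v (a : R) x : dir v (fun=> a) x = 0.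
Proof. by rewrite /dir big1 // => i _; rewrite partial_cst mulr0. Qed.

(** Logarithmic differentiation, through which the lengths |Z_m| become
    the functions log |Z_m|. *)
Lemma dir_ln v f x : (forall y, A y -> 0 < f y) -> Ck 1 A f -> A x ->
  dir v (fun y => ln (f y)) x = (f x)^-1 * dir v f x.
Proof.
move=> f0 Cf Ax; rewrite /dir mulr_sumr; apply: eq_bigr => i _ /=.
have [_ E] := partial_ln (f0 _ Ax) (Ck_derivable (i := i) Cf Ax).
by rewrite [X in _ * X]E mulrCA.
Qed.

Lemma dir_linear a v w f x : dir (a *: v + w) f x = a * dir v f x + dir w f x.
Proof.
rewrite /dir mulr_sumr -big_split; apply: eq_bigr => i _ /=.
by rewrite !mxE mulrDl mulrA.
Qed.

End MatrixCalculus.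

(** * The Levi-Civita connection in coordinates *)

Section InnerProduct.
Variables (R : realType) (d : nat).
Implicit Types (A : 'M[R]_d) (v w : 'rV[R]_d).

Lemma innerC A v w : A^T = A -> inner A v w = inner A w v.
Proof.
move=> sA; rewrite /inner; transitivity ((v *m A *m w^T)^T 0 0); first by rewrite [RHS]mxE.
by rewrite !trmx_mul trmxK sA mulmxA.
Qed.

Lemma innerDl A v v' w : inner A (v + v') w = inner A v w + inner A v' w.
Proof. by rewrite /inner !mulmxDl mxE. Qed.

Lemma innerZl A (a : R) v w : inner A (a *: v) w = a * inner A v w.
Proof. by rewrite /inner -!scalemxAl mxE. Qed.

Lemma innerZr A (a : R) v w : inner A v (a *: w) = a * inner A v w.
Proof. by rewrite /inner linearZ /= -scalemxAr mxE. Qed.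

Lemma inner_suml A (I : Type) (r : seq I) (P : pred I) (F : I -> 'rV[R]_d) w :
  inner A (\sum_(i <- r | P i) F i) w = \sum_(i <- r | P i) inner A (F i) w.
Proof. by rewrite /inner !mulmx_suml summxE. Qed.

Lemma inner_sumr A (I : Type) (r : seq I) (P : pred I) (F : I -> 'rV[R]_d) v :
  inner A v (\sum_(i <- r | P i) F i) = \sum_(i <- r | P i) inner A v (F i).
Proof. by rewrite /inner linear_sum mulmx_sumr summxE. Qed.

End InnerProduct.

Section Christoffel.
Variables (R : realType) (d : nat) (G : 'rV[R]_d -> 'M[R]_d).
Variables (A : set 'rV[R]_d).
Hypotheses (oA : open A) (sG : forall z, A z -> (G z)^T = G z)
  (uG : forall z, A z -> G z \in unitmx) (CG : mxCk 2 A G).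
Implicit Types (x z : 'rV[R]_d) (i j k l : 'I_d) (X Y : 'rV[R]_d -> 'rV[R]_d).

(** The matrix of w -> Gamma(d_i, w) acting on rows: entry (j, k) is
    Gamma^k_ij. In this form the curvature is a curl plus a commutator. *)
Definition chrmx i z : 'M[R]_d := \matrix_(j, k) christoffel G k i j z.

(** Row i is the derivative along the i-th coordinate field, so that the
    derivative along v is the product of the row v with this matrix. *)
Definition nabla Y z : 'M[R]_d := \matrix_(i, k) covariant G Y i z 0 k.

Lemma partial_metricC l i j z : A z ->
  partial l (fun y => G y i j) z = partial l (fun y => G y j i) z.
Proof.
move=> Az; apply: (partial_eq_on _ oA) => // y Ay.
by rewrite -[in LHS](sG Ay) mxE.
Qed.

Lemma chrmxC i j k z : A z -> chrmx i z j k = chrmx j z i k.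
Proof.
move=> Az; rewrite !mxE /christoffel; congr (_ * _).
apply: eq_bigr => l _; congr (_ * _).
by rewrite (partial_metricC l i j Az) [X in X - _]addrC.
Qed.

(** Koszul's formula: lowering the upper index removes the inverse metric. *)
Lemma chrmx_lower i j m z : A z ->
  (chrmx i z *m G z) j m
  = 2^-1 * (partial i (fun y => G y j m) z + partial j (fun y => G y i m) z
            - partial m (fun y => G y i j) z).
Proof.
move=> Az; pose S l : R := partial i (fun y => G y j l) z
  + partial j (fun y => G y i l) z - partial l (fun y => G y i j) z.
have -> : (chrmx i z *m G z) j m = 2^-1 * (\row_l S l *m invmx (G z)^T *m G z) 0 m.
  rewrite !mxE mulr_sumr; apply: eq_bigr => k _.
  rewrite !mxE /christoffel -mulrA; congr (_ * (_ * _)).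
  apply: eq_bigr => l _; rewrite mxE mulrC; congr (_ * _).
  by rewrite -[in RHS]trmx_inv mxE.
by rewrite (sG Az) mulmxKV ?uG // mxE.
Qed.

(** When Koszul's formula is added to its transpose, all derivatives of
    the metric cancel but one. *)
Lemma metric_parallel l z : A z ->
  mpartial l G z = chrmx l z *m G z + (chrmx l z *m G z)^T.
Proof.
move=> Az; apply/matrixP => i j; rewrite [LHS]mxE [RHS]mxE [X in _ + X]mxE.
rewrite !chrmx_lower // (partial_metricC l j i Az).
rewrite (partial_metricC i l j Az) (partial_metricC j l i Az).
have half (a b c : R) : a = 2^-1 * (a + b - c) + 2^-1 * (a + c - b) by field.
exact: half.
Qed.

Lemma nabla_row Y z i :
  row i (nabla Y z) = mpartial i Y z + Y z *m chrmx i z.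
Proof.
apply/rowP => k; rewrite !mxE; congr (_ + _).
by apply: eq_bigr => j _; rewrite !mxE mulrC.
Qed.

Lemma nablaE Y z i k :
  nabla Y z i k = partial i (fun y => Y y 0 k) z + (Y z *m chrmx i z) 0 k.
Proof.
have -> : nabla Y z i k = row i (nabla Y z) 0 k by rewrite [RHS]mxE.
by rewrite nabla_row [LHS]mxE; congr (_ + _); rewrite mxE.
Qed.

Lemma divergence_trace Y z : divergence G Y z = \tr (nabla Y z).
Proof. by apply: eq_bigr => i _; rewrite [RHS]mxE. Qed.

Lemma chrmx_C1 i : mxCk 1 A (chrmx i).
Proof.
have Ci : mxCk 1 A (metric_inv G).
  by apply: (mxCk_inv oA uG); exact: mxCk_le CG.
have CP l a b : Ck 1 A (partial l (fun y => G y a b)) by exact: Ck_partial (CG a b).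
move=> j k.
have C : Ck 1 A (christoffel G k i j).
  apply: (CkM oA); first exact: Ck_cst.
  apply: (Ck_sum oA) => l _; apply: (CkM oA); first exact: Ci.
  apply: (CkB oA); last exact: CP.
  by apply: (CkD oA); exact: CP.
by apply: (Ck_eq_on oA) C => z _; rewrite mxE.
Qed.

Lemma nabla_Ck (r : nat) Y :
  (r <= 1)%N -> mxCk r.+1 A Y -> mxCk r A (nabla Y).
Proof.
move=> r1 CY i j.
have C : Ck r A (fun z => partial i (fun y => Y y 0 j) z
    + (Y z *m chrmx i z) 0 j).
  apply: (CkD oA); first exact: Ck_partial (CY 0 j).
  apply: (mxCk_mul oA); first exact: mxCk_le CY.
  exact: mxCk_le (chrmx_C1 i).
by apply: (Ck_eq_on oA) C => z _; rewrite nablaE.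
Qed.

(** Compatibility of the connection with the metric, as a product rule. *)
Lemma dir_inner X Y v z : mxCk 1 A X -> mxCk 1 A Y -> A z ->
  dir v (fun y => inner (G y) (X y) (Y y)) z
  = inner (G z) (v *m nabla X z) (Y z) + inner (G z) (X z) (v *m nabla Y z).
Proof.
move=> CX CY Az.
have CG1 : mxCk 1 A G by exact: mxCk_le CG.
have E i : partial i (fun y => inner (G y) (X y) (Y y)) z
   = inner (G z) (row i (nabla X z)) (Y z) + inner (G z) (X z) (row i (nabla Y z)).
  have -> : partial i (fun y => inner (G y) (X y) (Y y)) z
     = (mpartial i (fun y => X y *m G y *m (Y y)^T) z) 0 0 by rewrite mxE.
  have CXG := mxCk_mul oA CX CG1.
  rewrite (mpartialM _ CXG (mxCk_tr oA CY) Az) (mpartialM _ CX CG1 Az).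
  rewrite mpartial_tr !nabla_row (metric_parallel i Az) /inner.
  rewrite trmx_mul (sG Az) !linearD /= trmx_mul !(mulmxDl, mulmxDr) !mulmxA !mxE.
  have assoc (a b c e : R) : a + (b + c) + e = a + b + (e + c) by ring.
  exact: assoc.
rewrite /dir (eq_bigr _ (fun i _ => congr1 (fun t => v 0 i * t) (E i))).
rewrite (eq_bigr (fun i => inner (G z) (v 0 i *: row i (nabla X z)) (Y z)
   + inner (G z) (X z) (v 0 i *: row i (nabla Y z)))); last first.
  by move=> i _; rewrite innerZl innerZr mulrDr.
rewrite big_split /=; congr (_ + _).
  by rewrite mulmx_sum_row inner_suml.
by rewrite mulmx_sum_row inner_sumr.
Qed.

Lemma nabla_scale (f : 'rV[R]_d -> R) Y z : Ck 1 A f -> mxCk 1 A Y -> A z ->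
  nabla (fun y => f y *: Y y) z
  = f z *: nabla Y z + (\col_i partial i f z) *m Y z.
Proof.
move=> Cf CY Az; apply/row_matrixP => i.
rewrite nabla_row linearD linearZ /= nabla_row (mpartialZ _ Cf CY Az).
rewrite row_mul (_ : row i (\col_i0 partial i0 f z) = (partial i f z)%:M); last first.
  by apply/rowP => k; rewrite !mxE ord1 eqxx mulr1n.
by rewrite mul_scalar_mx -scalemxAl scalerDr [RHS]addrC addrA.
Qed.

Lemma nabla_sum (I : Type) (r : seq I) (P : pred I)
    (Y : I -> 'rV[R]_d -> 'rV[R]_d) z :
  (forall a, P a -> mxCk 1 A (Y a)) -> A z ->
  nabla (fun y => \sum_(a <- r | P a) Y a y) z
  = \sum_(a <- r | P a) nabla (Y a) z.
Proof.
move=> CY Az; apply/row_matrixP => i.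
rewrite nabla_row (mpartial_sum i r CY Az) mulmx_suml -big_split linear_sum.
by apply: eq_bigr => a _; rewrite /= nabla_row.
Qed.

(** For a torsion-free connection this is the Lie bracket of the two
    fields; [dir_bracket] is the property that characterises it. *)
Definition bracket X Y z : 'rV[R]_d := X z *m nabla Y z - Y z *m nabla X z.

(** A bracket acts on functions as the commutator of two derivations: the
    second derivatives of u cancel by Schwarz's theorem, and the
    Christoffel terms by their symmetry. *)
Lemma dir_bracket X Y u z : mxCk 1 A X -> mxCk 1 A Y -> Ck 2 A u -> A z ->
  dir (bracket X Y z) u z
  = dir (X z) (fun y => dir (Y y) u y) z - dir (Y z) (fun y => dir (X y) u y) z.
Proof.
move=> CX CY Cu Az.
have expand X' Y' : mxCk 1 A X' -> mxCk 1 A Y' ->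
    dir (X' z) (fun y => dir (Y' y) u y) z
    = dir (X' z *m nabla Y' z) u z
      - \sum_i \sum_j X' z 0 i * (Y' z *m chrmx i z) 0 j * partial j u z
      + \sum_i \sum_j X' z 0 i * Y' z 0 j * partial i (partial j u) z.
  move=> CX' CY'.
  have -> : dir (X' z) (fun y => dir (Y' y) u y) z
     = \sum_i \sum_j (X' z 0 i * (partial i (fun y => Y' y 0 j) z * partial j u z)
        + X' z 0 i * (Y' z 0 j * partial i (partial j u) z)).
    apply: eq_bigr => i _; rewrite [X in _ * X]partial_bigsum => [|j _]; last first.
      apply: derivableM; first exact: Ck_derivable (CY' 0 j) Az.
      exact: Ck_derivable (Ck_partial j Cu) Az.
    rewrite mulr_sumr; apply: eq_bigr => j _.
    rewrite [X in _ * X]partialM ?mulrDr //; first exact: Ck_derivable (CY' 0 j) Az.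
    exact: Ck_derivable (Ck_partial j Cu) Az.
  have -> : dir (X' z *m nabla Y' z) u z
     = \sum_i \sum_j (X' z 0 i * (partial i (fun y => Y' y 0 j) z * partial j u z)
         + X' z 0 i * (Y' z *m chrmx i z) 0 j * partial j u z).
    rewrite exchange_big; apply: eq_bigr => j _ /=.
    rewrite mxE mulr_suml; apply: eq_bigr => i _.
    by rewrite nablaE mulrDr mulrDl -!mulrA.
  rewrite -sumrB -big_split; apply: eq_bigr => i _ /=.
  rewrite -sumrB -big_split; apply: eq_bigr => j _ /=.
  by rewrite addrK -[X in _ = _ + X]mulrA.
rewrite (expand _ _ CX CY) (expand _ _ CY CX).
have -> : \sum_i \sum_j Y z 0 i * (X z *m chrmx i z) 0 j * partial j u z
   = \sum_i \sum_j X z 0 i * (Y z *m chrmx i z) 0 j * partial j u z.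
  have flat X' Y' : \sum_i \sum_j Y' z 0 i * (X' z *m chrmx i z) 0 j * partial j u z
    = \sum_i \sum_k \sum_j Y' z 0 i * X' z 0 k * chrmx i z k j * partial j u z.
    apply: eq_bigr => i _; rewrite exchange_big; apply: eq_bigr => j _ /=.
    by rewrite mxE mulr_sumr mulr_suml; apply: eq_bigr => k _; rewrite !mulrA.
  rewrite !flat exchange_big; apply: eq_bigr => i _; apply: eq_bigr => k _ /=.
  by apply: eq_bigr => j _; rewrite (chrmxC i k j Az) [X z 0 i * _]mulrC.
have -> : \sum_i \sum_j Y z 0 i * X z 0 j * partial i (partial j u) z
   = \sum_i \sum_j X z 0 i * Y z 0 j * partial i (partial j u) z.
  rewrite exchange_big; apply: eq_bigr => i _; apply: eq_bigr => j _ /=.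
  have swap (a b e e' : R) : e = e' -> a * b * e = b * a * e'.
    by move=> ->; rewrite (mulrC a).
  by apply: swap; exact: (partialC _ _ oA Cu Az).
have -> : dir (bracket X Y z) u z
   = dir (X z *m nabla Y z) u z - dir (Y z *m nabla X z) u z.
  rewrite /bracket addrC -scaleN1r dir_linear.
  by rewrite mulN1r addrC.
have cancel (a b c e : R) : a - b = a - c + e - (b - c + e) by ring.
exact: cancel.
Qed.

End Christoffel.

(** * Bochner's formula *)

Section Bochner.
Variables (R : realType) (d : nat) (G : 'rV[R]_d -> 'M[R]_d).
Variables (A : set 'rV[R]_d).
Hypotheses (oA : open A) (sG : forall z, A z -> (G z)^T = G z)
  (uG : forall z, A z -> G z \in unitmx) (CG : mxCk 2 A G).
Implicit Types (z : 'rV[R]_d) (i j k l : 'I_d) (X : 'rV[R]_d -> 'rV[R]_d).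

Let chr i := chrmx G i.
Let Cchr i : mxCk 1 A (chr i). Proof. exact: (chrmx_C1 oA uG CG). Qed.

Lemma riemannE l k i j z : A z ->
  riemann G l k i j z
  = (mpartial i (chr j) z - mpartial j (chr i) z
     + (chr j z *m chr i z - chr i z *m chr j z)) k l.
Proof.
move=> Az.
have P a b : mpartial a (chr b) z k l = partial a (christoffel G l b k) z.
  by rewrite mxE; apply: near_partial; near=> y; rewrite mxE.
have subE (M1 M2 : 'M[R]_d) : (M1 - M2) k l = M1 k l - M2 k l by rewrite !mxE.
rewrite /riemann -!P [RHS]mxE !subE; congr (_ + _).
rewrite [X in _ = X - _]mxE [X in _ = _ - X]mxE -sumrB.
apply: eq_bigr => m _; rewrite [chr j z _ _]mxE [chr j z _ _]mxE.
by rewrite [chr i z _ _]mxE [chr i z _ _]mxE mulrC; congr (_ - _); rewrite mulrC.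
Unshelve. all: by end_near. Qed.

(** The commutator of two covariant derivatives of X is the curvature
    applied to X, because the mixed partial derivatives of X agree. *)
Lemma ricci_identity X i j z : mxCk 2 A X -> A z ->
  X z *m (mpartial i (chr j) z - mpartial j (chr i) z
     + (chr j z *m chr i z - chr i z *m chr j z))
  = (row j (mpartial i (nabla G X) z) + row j (nabla G X z) *m chr i z)
    - (row i (mpartial j (nabla G X) z) + row i (nabla G X z) *m chr j z).
Proof.
move=> CX Az.
have CX1 : mxCk 1 A X by exact: mxCk_le CX.
have P a b : row b (mpartial a (nabla G X) z)
   = mpartial a (mpartial b X) z + mpartial a X z *m chr b z
     + X z *m mpartial a (chr b) z.
  have -> : row b (mpartial a (nabla G X) z)
      = mpartial a (fun y => mpartial b X y + X y *m chr b y) z.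
    apply/rowP => k; rewrite [LHS]mxE [LHS]mxE [RHS]mxE.
    apply: near_partial; near=> y.
    by rewrite -(nabla_row G X y b) [RHS]mxE.
  have CmX : mxCk 1 A (mpartial b X) by exact: (mxCk_partial oA).
  have CXc : mxCk 1 A (fun y => X y *m chr b y) by exact: (mxCk_mul oA).
  by rewrite (mpartialD a CmX CXc Az) (mpartialM a CX1 (Cchr b) Az) addrA.
rewrite !P !nabla_row (mpartialC oA j i CX Az).
have key (v a b e : 'rV[R]_d) (P1 Q1 cj ci : 'M[R]_d) :
    v *m (P1 - Q1 + (cj *m ci - ci *m cj))
    = a + b *m cj + v *m P1 + (e + v *m cj) *m ci
      - (a + e *m ci + v *m Q1 + (b + v *m ci) *m cj).
  rewrite !(mulmxDr, mulmxN) !mulmxDl !mulmxA.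
  move: (v *m P1) (v *m Q1) (v *m cj *m ci) (v *m ci *m cj) (b *m cj) (e *m ci).
  move=> c f g h b' e'; apply/rowP => k; rewrite !mxE.
  have comp (a1 b1 c1 e1 f1 g1 h1 : R) : c1 - f1 + (g1 - h1)
    = a1 + b1 + c1 + (e1 + g1) - (a1 + e1 + f1 + (b1 + h1)) by ring.
  exact: comp.
exact: key.
Unshelve. all: by end_near. Qed.

(** Ric(X, X) = div (nabla_X X) - X (div X) - tr ((nabla X)^2). This is
    [ricci_identity] contracted with X; the trace of the square appears
    when X is moved inside the outer derivative. *)
Lemma bochner X z : mxCk 2 A X -> A z ->
  \sum_j \sum_k X z 0 j * X z 0 k * ricci G j k z
  = \tr (nabla G (fun y => X y *m nabla G X y) z)
    - dir (X z) (fun y => \tr (nabla G X y)) z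
    - \tr (nabla G X z *m nabla G X z).
Proof.
move=> CX Az.
have CX1 : mxCk 1 A X by exact: mxCk_le CX.
have CN : mxCk 1 A (nabla G X) by by apply: (nabla_Ck oA uG CG).
set N := nabla G X z.
pose PN i := mpartial i (nabla G X) z.
have lhsE : \sum_j \sum_k X z 0 j * X z 0 k * ricci G j k z
   = \sum_i \sum_j (X z 0 j * PN i j i + X z 0 j * (N *m chr i z) j i
        - (X z 0 j * PN j i i + X z 0 j * (N *m chr j z) i i)).
  transitivity (\sum_j \sum_i X z 0 j *
     (X z *m (mpartial i (chr j) z - mpartial j (chr i) z
     + (chr j z *m chr i z - chr i z *m chr j z))) 0 i).
    apply: eq_bigr => j _; rewrite /ricci.
    under eq_bigr do rewrite mulr_sumr.
    rewrite exchange_big; apply: eq_bigr => i _ /=.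
    rewrite [X in _ = _ * X]mxE mulr_sumr; apply: eq_bigr => k _.
    by rewrite (riemannE _ _ _ _ Az) mulrA.
  rewrite exchange_big; apply: eq_bigr => i _; apply: eq_bigr => j _ /=.
  rewrite (ricci_identity _ _ CX Az) -!row_mul -!mulrDr -mulrBr; congr (_ * _).
  have ent (a b c e : 'rV[R]_d) k :
    (a + b - (c + e)) 0 k = a 0 k + b 0 k - (c 0 k + e 0 k) by rewrite !mxE.
  rewrite ent -/N -/(PN i) -/(PN j).
  by congr (_ + _ - (_ + _)); rewrite [LHS]mxE.
have divE : \tr (nabla G (fun y => X y *m nabla G X y) z)
   = \sum_i ((mpartial i X z *m N) 0 i
       + \sum_j (X z 0 j * PN i j i + X z 0 j * (N *m chr i z) j i)).
  apply: eq_bigr => i _; rewrite nablaE.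
  have -> : partial i (fun y => (X y *m nabla G X y) 0 i) z
     = (mpartial i (fun y => X y *m nabla G X y) z) 0 i by rewrite mxE.
  rewrite (mpartialM _ CX1 CN Az) -mulmxA big_split /= addrA [X in X + _ = _]mxE.
  by congr (_ + _ + _); rewrite mxE.
have dirE : dir (X z) (fun y => \tr (nabla G X y)) z
   = \sum_i \sum_j X z 0 j * PN j i i.
  rewrite exchange_big; apply: eq_bigr => j _ /=.
  rewrite -mulr_sumr; congr (_ * _); rewrite partial_bigsum.
    by apply: eq_bigr => i _; rewrite mxE.
  by move=> i _; exact: Ck_derivable (CN i i) Az.
have trE : \tr (N *m N)
   = \sum_i ((mpartial i X z *m N) 0 i + (X z *m chr i z *m N) 0 i).
  apply: eq_bigr => i _.
  have -> : (N *m N) i i = (row i N *m N) 0 i by rewrite -row_mul [RHS]mxE.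
  by rewrite nabla_row mulmxDl mxE.
(* The Christoffel part of the derivative of X and that of the derivative
   of nabla X meet by the symmetry of the Christoffel symbols. *)
have crossE : \sum_i (X z *m chr i z *m N) 0 i
   = \sum_i \sum_j X z 0 j * (N *m chr j z) i i.
  transitivity (\sum_i \sum_j \sum_m X z 0 m * chr m z i j * N j i).
    apply: eq_bigr => i _; rewrite mxE; apply: eq_bigr => j _.
    rewrite mxE mulr_suml; apply: eq_bigr => m _.
    by rewrite /chr (chrmxC oA sG i m j Az).
  rewrite exchange_big; apply: eq_bigr => j _ /=.
  rewrite exchange_big; apply: eq_bigr => m _ /=.
  rewrite mxE mulr_sumr; apply: eq_bigr => i _.
  by rewrite -mulrA [chr m z i j * _]mulrC.
rewrite lhsE divE dirE trE big_split big_split /= crossE.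
have split_sum (F H K : 'I_d -> 'I_d -> R) :
    \sum_i \sum_j (F i j - (H i j + K i j))
    = \sum_i \sum_j F i j - (\sum_i \sum_j H i j + \sum_i \sum_j K i j).
  rewrite -big_split -sumrB; apply: eq_bigr => i _ /=.
  by rewrite -big_split -sumrB.
rewrite split_sum.
move: (\sum_i (mpartial i X z *m N) 0 i) => a.
have comp (b c e : R) : b - (c + e) = a + b - c - (a + e) by ring.
exact: comp.
Qed.

End Bochner.

(** * Orthonormal frames *)

Section OrthonormalFrame.
Variables (R : realType) (n : nat) (G : 'rV[R]_n -> 'M[R]_n).
Variables (A : set 'rV[R]_n).
Hypotheses (oA : open A) (sG : forall z, A z -> (G z)^T = G z)
  (uG : forall z, A z -> G z \in unitmx) (CG : mxCk 2 A G).
Variable (e : nat -> 'rV[R]_n -> 'rV[R]_n).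
Hypothesis Ce : forall i, (i < n)%N -> mxCk 2 A (e i).
Hypothesis onb : forall z i j, A z -> (i < n)%N -> (j < n)%N ->
  inner (G z) (e i z) (e j z) = (i == j)%:R.
Implicit Types (z : 'rV[R]_n) (i j k l : 'I_n) (f : 'rV[R]_n -> R).

Let Ce2 i : mxCk 2 A (e i). Proof. exact: Ce. Qed.
Let Ce1 i : mxCk 1 A (e i). Proof. exact: mxCk_le (Ce2 i). Qed.

Definition framemx z : 'M[R]_n := \matrix_i e i z.

(** The connection coefficients Gamma_ijk = <nabla_{e_i} e_j, e_k> of the
    frame. *)
Definition conn (i j k : nat) z : R :=
  inner (G z) (e i z *m nabla G (e j) z) (e k z).

Lemma framemx_orthonormal z : A z -> framemx z *m G z *m (framemx z)^T = 1%:M.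
Proof.
move=> Az; apply/matrixP => i j; rewrite [RHS]mxE.
rewrite -(onb Az (ltn_ord i) (ltn_ord j)) /inner.
rewrite [LHS]mxE [RHS]mxE; apply: eq_bigr => k _.
rewrite [X in _ * X]mxE [framemx z j k]mxE [X in _ = _ * X]mxE; congr (_ * _).
by rewrite [LHS]mxE [RHS]mxE; apply: eq_bigr => l _; rewrite [framemx z _ _]mxE.
Qed.

(** By orthonormality, G times the transposed frame matrix is a right
    inverse of the frame matrix, hence also a left inverse. *)
Lemma framemx_complete z : A z -> (framemx z)^T *m framemx z *m G z = 1%:M.
Proof.
move=> Az; have := framemx_orthonormal Az.
rewrite -mulmxA => /mulmx1C E; apply: trmx_inj.
by rewrite !trmx_mul trmxK (sG Az) mulmxA trmx1.
Qed.

Lemma metric_inv_frame z k l : A z ->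
  metric_inv G z k l = \sum_(i < n) e i z 0 k * e i z 0 l.
Proof.
move=> Az; have E := framemx_complete Az.
have -> : metric_inv G z = (framemx z)^T *m framemx z.
  by rewrite -[RHS](mulmxK (uG Az)) E mul1mx.
rewrite mxE; apply: eq_bigr => i _.
by rewrite mxE [framemx z i k]mxE [framemx z i l]mxE.
Qed.

Lemma frame_expansion z v : A z -> v = \sum_(i < n) inner (G z) v (e i z) *: e i z.
Proof.
move=> Az; apply/rowP => k.
rewrite -[v in LHS](mulmx1 v) -[1%:M]trmx1 -(framemx_complete Az).
rewrite !trmx_mul trmxK (sG Az) !mulmxA mxE summxE; apply: eq_bigr => i _.
rewrite [in RHS]mxE [framemx z i k]mxE; congr (_ * _).
rewrite /inner [LHS]mxE [RHS]mxE; apply: eq_bigr => l _.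
by rewrite [X in _ * X]mxE [framemx z i l]mxE [X in _ = _ * X]mxE.
Qed.

Lemma trace_frame (N : 'M[R]_n) z : A z ->
  \tr N = \sum_(i < n) inner (G z) (e i z *m N) (e i z).
Proof.
move=> Az; rewrite -[N in LHS](mulmx1 N) -(mulmx1C (framemx_complete Az)).
rewrite !mulmxA mxtrace_mulC !mulmxA /mxtrace; apply: eq_bigr => i _.
have -> : (framemx z *m N *m G z *m (framemx z)^T) i i
   = (row i (framemx z) *m N *m G z *m (framemx z)^T) 0 i.
  by rewrite -!row_mul [RHS]mxE.
rewrite rowK /inner [LHS]mxE [RHS]mxE; apply: eq_bigr => l _.
by rewrite [X in _ * X]mxE [framemx z i l]mxE [X in _ = _ * X]mxE.
Qed.

Lemma trace_mul_frame (N : 'M[R]_n) z : A z ->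
  \tr (N *m N) = \sum_(i < n) \sum_(k < n) inner (G z) (e i z *m N) (e k z)
    * inner (G z) (e k z *m N) (e i z).
Proof.
move=> Az; rewrite (trace_frame _ Az); apply: eq_bigr => i _.
rewrite mulmxA {1}(frame_expansion (e i z *m N) Az) mulmx_suml inner_suml.
by apply: eq_bigr => k _; rewrite -scalemxAl innerZl.
Qed.

(** The inner products of frame vectors are constant, so their derivatives
    vanish. *)
Lemma conn_anti i j k z : A z -> conn i j k z = - conn i k j z.
Proof.
move=> Az.
have := dir_inner oA sG uG CG (e i z) (Ce1 j) (Ce1 k) Az.
have -> : dir (e i z) (fun y => inner (G y) (e j y) (e k y)) z = 0.
  rewrite -[RHS](dir_cst (e i z) ((j == k)%:R : R) z).
  apply: (dir_eq_on oA) => // y Ay; exact: onb.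
rewrite [X in _ = _ + X](innerC _ _ (sG Az)) => /esym/eqP.
by rewrite addr_eq0 => /eqP.
Qed.

Lemma conn_diag i j z : A z -> conn i j j z = 0.
Proof.
move=> Az; have := conn_anti i j j Az; set a := conn _ _ _ _ => /eqP.
by rewrite -subr_eq0 opprK -mulr2n mulrn_eq0 => /eqP.
Qed.

Lemma conn_C1 i j k : Ck 1 A (conn i j k).
Proof.
apply: (mxCk_mul oA _ (mxCk_tr oA (Ce1 k))).
apply: (mxCk_mul oA _ (mxCk_le (leqnSn 1) CG)).
apply: (mxCk_mul oA (Ce1 i)).
by apply: (nabla_Ck oA uG CG).
Qed.

Lemma nabla_eq_on (X Y : 'rV[R]_n -> 'rV[R]_n) z :
  (forall y, A y -> X y = Y y) -> A z -> nabla G X z = nabla G Y z.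
Proof.
move=> XY Az; apply/row_matrixP => i.
by rewrite !nabla_row (XY z Az) (mpartial_eq_on oA _ XY Az).
Qed.

Lemma trace_nabla_scale f (Y : 'rV[R]_n -> 'rV[R]_n) z :
  Ck 1 A f -> mxCk 1 A Y -> A z ->
  \tr (nabla G (fun y => f y *: Y y) z) = f z * \tr (nabla G Y z) + dir (Y z) f z.
Proof.
move=> Cf CY Az; rewrite (nabla_scale _ Cf CY Az) linearD linearZ /=.
congr (_ + _); rewrite mxtrace_mulC /mxtrace big_ord1 mxE.
by apply: eq_bigr => i _; rewrite mxE.
Qed.

Definition frame_div (i : nat) z : R := \tr (nabla G (e i) z).

Lemma frame_divE i z : A z -> frame_div i z = \sum_(j < n) conn j i j z.
Proof. by move=> Az; exact: trace_frame. Qed.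

Lemma frame_div_C1 i : Ck 1 A (frame_div i).
Proof.
apply: (Ck_sum oA) => j _.
have CN : mxCk 1 A (nabla G (e i)) by apply: (nabla_Ck oA uG CG).
exact: CN.
Qed.

(** By antisymmetry of the connection coefficients, the component of the
    left-hand side along e_k is minus the divergence of e_k. *)
Lemma sum_nabla_frame z : A z ->
  \sum_(i < n) e i z *m nabla G (e i) z = \sum_(k < n) (- frame_div k z) *: e k z.
Proof.
move=> Az; rewrite [LHS](frame_expansion _ Az); apply: eq_bigr => k _.
congr (_ *: _); rewrite inner_suml (frame_divE _ Az) -sumrN.
by apply: eq_bigr => i _; exact: conn_anti.
Qed.

(** Bochner's formula summed over the frame. The sum of the fields
    nabla_{e_i} e_i is known from [sum_nabla_frame], so the scalar
    curvature is expressed through the divergences of the frame vectors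
    and one quadratic term in the connection coefficients. *)
Lemma scalar_curvature_frame z : A z ->
  scalar_curvature G z
  = - 2 * \sum_(i < n) dir (e i z) (frame_div i) z - \sum_(i < n) frame_div i z ^+ 2
    - \sum_(j < n) \sum_(i < n) \sum_(k < n) conn i j k z * conn k j i z.
Proof.
move=> Az.
have -> : scalar_curvature G z
   = \sum_(a < n) \sum_j \sum_k e a z 0 j * e a z 0 k * ricci G j k z.
  rewrite exchange_big; apply: eq_bigr => j _ /=.
  rewrite exchange_big; apply: eq_bigr => k _ /=.
  by rewrite (metric_inv_frame _ _ Az) mulr_suml.
under eq_bigr do rewrite (bochner oA sG uG CG (Ce2 _) Az).
rewrite !sumrB.
have -> : \sum_(i < n) \tr (nabla G (fun y => e i y *m nabla G (e i) y) z)
   = - \sum_(i < n) dir (e i z) (frame_div i) z - \sum_(i < n) frame_div i z ^+ 2.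
  have CY i : mxCk 1 A (fun y => e i y *m nabla G (e i) y).
    by apply: (mxCk_mul oA) => //; apply: (nabla_Ck oA uG CG).
  have CZ k : mxCk 1 A (fun y => (- frame_div k y) *: e k y).
    by apply: (mxCk_scale oA) => //; apply: (CkN oA); exact: frame_div_C1.
  rewrite -linear_sum -(nabla_sum _ _ (fun i _ => CY i) Az).
  rewrite (nabla_eq_on sum_nabla_frame Az) (nabla_sum _ _ (fun i _ => CZ i) Az).
  rewrite linear_sum /= -!sumrN -big_split; apply: eq_bigr => i _ /=.
  rewrite trace_nabla_scale //; last by apply: (CkN oA); exact: frame_div_C1.
  by rewrite (dirN _ (frame_div_C1 i) Az) mulNr expr2 addrC.
have -> : \sum_(i < n) \tr (nabla G (e i) z *m nabla G (e i) z)
   = \sum_(j < n) \sum_(i < n) \sum_(k < n) conn i j k z * conn k j i z.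
  by apply: eq_bigr => j _; rewrite (trace_mul_frame _ Az).
move: (\sum_(i < n) dir _ _ _) (\sum_(i < n) frame_div i z ^+ 2) => a b.
move: (\sum_(j < n) \sum_(i < n) \sum_(k < n) _) => c.
have comp : - a - b - a - c = - 2 * a - b - c by ring.
exact: comp.
Qed.

Lemma gradient_frame f z : A z ->
  gradient G f z = \sum_(i < n) dir (e i z) f z *: e i z.
Proof.
move=> Az; apply/rowP => k; rewrite [LHS]mxE summxE.
under eq_bigr do rewrite (metric_inv_frame _ _ Az) mulr_suml.
rewrite exchange_big; apply: eq_bigr => i _ /=; rewrite [RHS]mxE mulr_suml.
have swap (a b p : R) : a * b * p = b * p * a by ring.
by apply: eq_bigr => l _; exact: swap.
Qed.

Lemma sqnorm_frame z (a : nat -> R) : A z ->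
  inner (G z) (\sum_(i < n) a i *: e i z) (\sum_(i < n) a i *: e i z)
  = \sum_(i < n) a i ^+ 2.
Proof.
move=> Az; rewrite inner_suml; apply: eq_bigr => i _.
rewrite innerZl inner_sumr (bigD1 i) //= innerZr onb // eqxx mulr1.
rewrite big1 ?addr0 ?expr2 // => j ji; rewrite innerZr onb //.
by rewrite (_ : (i == j :> nat) = false) ?mulr0 //; apply/negbTE; rewrite eq_sym.
Qed.

Lemma laplacian_frame f z : Ck 2 A f -> A z ->
  laplacian G f z = \sum_(i < n) (dir (e i z) (fun y => dir (e i y) f y) z
    + frame_div i z * dir (e i z) f z).
Proof.
move=> Cf Az; rewrite /laplacian divergence_trace.
have Cd i : Ck 1 A (fun y => dir (e i y) f y) by exact: (Ck_dir oA).
rewrite (nabla_eq_on (gradient_frame f) Az).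
have CZ i : mxCk 1 A (fun y => dir (e i y) f y *: e i y).
  exact: (mxCk_scale oA).
rewrite (nabla_sum _ _ (fun i _ => CZ i) Az) linear_sum /=.
apply: eq_bigr => i _; rewrite (trace_nabla_scale (Cd i) (Ce1 i) Az).
by rewrite addrC mulrC.
Qed.

End OrthonormalFrame.

(** * Frames adapted to a flag of foliations *)

Section FlagConnection.
Variables (R : realType) (n : nat) (c : nat -> nat -> nat -> R).
Hypothesis anti : forall i j k : 'I_n, c i j k = - c i k j.
Hypothesis flag : forall i j k : 'I_n, (k < i)%N -> (k < j)%N ->
  c i j k = c j i k.
Implicit Types i j k : 'I_n.

Let c0 i j : c i j j = 0.
Proof.
have := anti i j j; set a := c _ _ _ => /eqP.
by rewrite -subr_eq0 opprK -mulr2n mulrn_eq0 => /eqP.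
Qed.

(** The quadratic term of [scalar_curvature_frame] is a sum of squares
    when the frame is adapted to a flag. For indices a < b < c the
    condition reads Gamma_bca = Gamma_cba: the terms with middle index b
    cancel those with middle index c, and each term with middle index a is
    a square. A term in which two of the indices coincide is zero or a
    square. *)
Lemma flag_connection_trace :
  \sum_(j < n) \sum_(i < n) \sum_(k < n) c i j k * c k j i
  = \sum_(j < n) \sum_(i < n | (j <= i)%N) \sum_(k < n | (j <= k)%N) c i j k ^+ 2.
Proof.
pose T i j k := c i j k * c k j i.
(* T is split according to which index is smallest: the middle one (U),
   both outer ones, equal (D), the first alone (V), or the last alone (V
   with its outer indices exchanged). If the middle index equals an outer
   one, T vanishes by antisymmetry. *)
pose V i j k := if (i < j)%N && (i < k)%N then T i j k else 0.
pose U i j k := if (j < i)%N && (j < k)%N then c i j k ^+ 2 else 0.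
pose D i j k := if (i == k) && (k < j)%N then c i i j ^+ 2 else 0.
have TE i j k : T i j k = U i j k + D i j k + V i j k + V k j i.
  have Tsym : T k j i = T i j k by rewrite /T mulrC.
  have [->|ik] := eqVneq i k.
    rewrite /U /D /V eqxx ltnn !andbF !addr0 !andbb /=.
    case: (ltngtP j k) => [jk|kj|/val_inj->]; rewrite ?addr0 ?add0r /T ?expr2 //.
      by rewrite (anti k k j) mulrNN.
    by rewrite c0 mul0r.
  rewrite /D (negPf ik) /= addr0 /U /V Tsym.
  case: (ltngtP i j) => [ij|ji|/val_inj ij]; case: (ltngtP k j) => [kj|jk|/val_inj kj];
    rewrite /= ?addr0 ?add0r.
  - case: (ltngtP i k) => [||/val_inj ik']; rewrite ?addr0 ?add0r //.
    by rewrite ik' eqxx in ik.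
  - by rewrite (ltn_trans ij jk).
  - by rewrite kj ij.
  - by rewrite (ltn_trans kj ji).
  - by rewrite {1}/T (anti i j k) (anti k j i) mulrNN (flag jk ji) expr2 mulrNN.
  - by rewrite {1}/T kj c0 mul0r.
  - by rewrite /T ij c0 mulr0 if_same.
  - by rewrite /T ij c0 mulr0.
  by rewrite -kj in ij; rewrite ij eqxx in ik.
(* With i smallest, exchanging j and k changes the sign of the term. *)
have V0 : \sum_(i < n) \sum_(j < n) \sum_(k < n) V i j k = 0.
  apply: big1 => i _.
  have N : \sum_(j < n) \sum_(k < n) V i j k = - \sum_(j < n) \sum_(k < n) V i j k.
    rewrite [LHS]exchange_big -sumrN; apply: eq_bigr => j _.
    rewrite -sumrN; apply: eq_bigr => k _; rewrite /V andbC.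
    case: ifP => [/andP[ik ij]|_]; last by rewrite oppr0.
    by rewrite /T (anti i k j) (flag ik ij) mulNr.
  move: N; set a := \sum_(j < n) _ => /eqP.
  by rewrite -subr_eq0 opprK -mulr2n mulrn_eq0 => /eqP.
have V1 : \sum_(j < n) \sum_(i < n) \sum_(k < n) V i j k = 0.
  by rewrite exchange_big.
have V2 : \sum_(j < n) \sum_(i < n) \sum_(k < n) V k j i = 0.
  rewrite -[RHS]V1; apply: eq_bigr => j _; exact: exchange_big.
transitivity (\sum_(j < n) \sum_(i < n) \sum_(k < n) (U i j k + D i j k)).
  transitivity (\sum_(j < n) \sum_(i < n) \sum_(k < n) (U i j k + D i j k)
     + \sum_(j < n) \sum_(i < n) \sum_(k < n) V i j k
     + \sum_(j < n) \sum_(i < n) \sum_(k < n) V k j i).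
    rewrite -!big_split; apply: eq_bigr => j _ /=.
    rewrite -!big_split; apply: eq_bigr => i _ /=.
    by rewrite -!big_split; apply: eq_bigr => k _ /=; rewrite -/(T i j k) TE.
  by rewrite V1 V2 !addr0.
pose D' i j k := if (i == j) && (j < k)%N then c j j k ^+ 2 else 0.
have DD : \sum_(j < n) \sum_(i < n) \sum_(k < n) D i j k
   = \sum_(j < n) \sum_(i < n) \sum_(k < n) D' i j k.
  transitivity (\sum_(i < n) \sum_(j < n | (i < j)%N) c i i j ^+ 2).
    rewrite exchange_big; apply: eq_bigr => i _ /=.
    rewrite [RHS]big_mkcond; apply: eq_bigr => j _ /=.
    rewrite (bigD1 i) //= big1 ?addr0 => [|k ki]; rewrite /D ?eqxx //.
    by rewrite eq_sym (negPf ki).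
  apply: eq_bigr => j _; rewrite [RHS](bigD1 j) //= [X in _ = _ + X]big1 ?addr0.
    by rewrite big_mkcond; apply: eq_bigr => k _; rewrite /D' eqxx.
  by move=> i ij; apply: big1 => k _; rewrite /D' (negPf ij).
transitivity (\sum_(j < n) \sum_(i < n) \sum_(k < n) (U i j k + D' i j k)).
  have S (F H : 'I_n -> 'I_n -> 'I_n -> R) :
      \sum_(j < n) \sum_(i < n) \sum_(k < n) (F i j k + H i j k)
      = \sum_(j < n) \sum_(i < n) \sum_(k < n) F i j k
        + \sum_(j < n) \sum_(i < n) \sum_(k < n) H i j k.
    rewrite -big_split; apply: eq_bigr => j _ /=; rewrite -big_split.
    by apply: eq_bigr => i _ /=; rewrite -big_split.
  by rewrite !S DD.
apply: eq_bigr => j _; rewrite [RHS]big_mkcond; apply: eq_bigr => i _ /=.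
case: ifPn => ji; last first.
  rewrite big1 // => k _; rewrite /U /D' ltnNge (ltnW _) ?ltnNge //= add0r.
  by rewrite (_ : (i == j) = false) //; apply/negbTE; apply: contraNneq ji => ->.
rewrite [RHS]big_mkcond; apply: eq_bigr => k _ /=.
rewrite /U /D'; have [->|ij] := eqVneq i j.
  rewrite ltnn /= add0r; case: (ltngtP j k) => // /val_inj->.
  by rewrite c0 expr0n.
rewrite (_ : (j < i)%N) /= ?addr0; last by rewrite ltn_neqAle ji eq_sym andbT.
case: (ltngtP j k) => // /val_inj->.
by rewrite c0 expr0n.
Qed.

End FlagConnection.

Section LevelFrame.
Variables (R : realType) (n : nat) (G : 'rV[R]_n -> 'M[R]_n).
Variables (A : set 'rV[R]_n).
Hypotheses (oA : open A) (sG : forall z, A z -> (G z)^T = G z)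
  (uG : forall z, A z -> G z \in unitmx) (CG : mxCk 2 A G).
Variable (e : nat -> 'rV[R]_n -> 'rV[R]_n).
Hypothesis Ce : forall i, (i < n)%N -> mxCk 2 A (e i).
Hypothesis onb : forall z i j, A z -> (i < n)%N -> (j < n)%N ->
  inner (G z) (e i z) (e j z) = (i == j)%:R.
Variables (u w : nat -> 'rV[R]_n -> R).
Hypothesis Cu : forall m, (m < n.-1)%N -> Ck 2 A (u m).
Hypothesis Cw : forall m, (m < n)%N -> Ck 2 A (w m).
Hypothesis w0 : forall m z, (m < n)%N -> A z -> 0 < w m z.
Hypothesis tangent : forall m l z, (l < m)%N -> (m < n)%N -> A z ->
  dir (e m z) (u l) z = 0.
Hypothesis level_gradient : forall m z v, (m < n.-1)%N -> A z ->
  (forall l, (l < m)%N -> dir v (u l) z = 0) ->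
  w m z * inner (G z) (e m z) v = w m.+1 z * dir v (u m) z.
Implicit Types (z : 'rV[R]_n).

Local Notation Gam := (conn G e).
Let f m y := ln (w m y).

Let Ce1 i : (i < n)%N -> mxCk 1 A (e i).
Proof. by move=> /Ce; exact: mxCk_le. Qed.

Lemma frame_bracket (i j k : nat) z :
  inner (G z) (bracket G (e i) (e j) z) (e k z) = Gam i j k z - Gam j i k z.
Proof. by rewrite /bracket -scaleN1r innerDl innerZl mulN1r. Qed.

(** Both derivations in the commutator of [dir_bracket] annihilate u_l. *)
Lemma bracket_tangent (i j l : nat) z : (l < i)%N -> (l < j)%N ->
  (i < n)%N -> (j < n)%N -> A z ->
  dir (bracket G (e i) (e j) z) (u l) z = 0.
Proof.
move=> li lj ni nj Az.
have ln : (l < n.-1)%N.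
  by apply: (leq_trans li); rewrite -ltnS prednK // (leq_ltn_trans _ ni).
rewrite (dir_bracket oA sG (Ce1 ni) (Ce1 nj) (Cu ln) Az).
have Z m i' : (l < m)%N -> (m < n)%N -> dir (e i' z) (fun y => dir (e m y) (u l) y) z = 0.
  move=> lm mn; rewrite -[RHS](dir_cst (e i' z) (0 : R) z).
  by apply: (dir_eq_on oA) => // y Ay; exact: tangent.
by rewrite !Z // subrr.
Qed.

(** Symmetry of the second fundamental form with normal e_k: the bracket
    of e_i and e_j is tangent to the level sets of u_k, so it has no
    component along e_k. *)
Lemma conn_flag (i j k : nat) z : (k < i)%N -> (k < j)%N ->
  (i < n)%N -> (j < n)%N -> A z -> Gam i j k z = Gam j i k z.
Proof.
move=> ki kj ni nj Az.
have kn : (k < n.-1)%N.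
  by apply: (leq_trans ki); rewrite -ltnS prednK // (leq_ltn_trans _ ni).
have := level_gradient kn Az
  (fun l lk => bracket_tangent (ltn_trans lk ki) (ltn_trans lk kj) ni nj Az).
rewrite (bracket_tangent ki kj ni nj Az) mulr0 => /eqP.
have kn' : (k < n)%N by exact: ltn_trans ki ni.
rewrite mulf_eq0 gt_eqF ?w0 //= (innerC _ _ (sG Az)) frame_bracket.
by rewrite subr_eq0 => /eqP.
Qed.

(** The defining property of the level gradient, tested on its own
    direction e_m. *)
Lemma dir_own_level m z : (m < n.-1)%N -> A z ->
  w m z = w m.+1 z * dir (e m z) (u m) z.
Proof.
move=> mn Az; have mn' : (m < n)%N by rewrite (leq_trans mn) ?leq_pred.
rewrite -(level_gradient mn Az) ?onb // ?eqxx ?mulr1 // => l lm.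
exact: tangent.
Qed.

(** The tangential part of nabla_{e_m} e_m is the tangential gradient of
    the logarithm of the derivative of u_m along e_m. This comes from
    applying the bracket of e_m and e_j to u_m, which e_j annihilates;
    [dir_own_level] then brings in w_m and w_{m+1}. *)
Lemma conn_shape (m j : nat) z : (m < j)%N -> (j < n)%N -> A z ->
  Gam m m j z = dir (e j z) (f m) z - dir (e j z) (f m.+1) z.
Proof.
move=> mj nj Az.
have mn : (m < n.-1)%N.
  by apply: (leq_trans mj); rewrite -ltnS prednK // (leq_ltn_trans _ nj).
have nm : (m < n)%N by exact: ltn_trans mj nj.
have nm1 : (m.+1 < n)%N by exact: leq_ltn_trans mj nj.
have := level_gradient (v := bracket G (e m) (e j) z) mn Az
  (fun l lm => bracket_tangent lm (ltn_trans lm mj) nm nj Az).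
rewrite (innerC _ _ (sG Az)) frame_bracket.
rewrite (dir_bracket oA sG (Ce1 nm) (Ce1 nj) (Cu mn) Az).
have -> : dir (e m z) (fun y => dir (e j y) (u m) y) z = 0.
  rewrite -[RHS](dir_cst (e m z) (0 : R) z).
  by apply: (dir_eq_on oA) => // y Ay; exact: tangent.
have -> : Gam j m m z = 0 by exact: (conn_diag oA sG uG CG Ce onb (Ordinal nj) (Ordinal nm) Az).
have -> : Gam m j m z = - Gam m m j z.
  exact: (conn_anti oA sG uG CG Ce onb (Ordinal nm) (Ordinal nj) (Ordinal nm) Az).
pose a y := dir (e m y) (u m) y.
have wa y : A y -> w m y = w m.+1 y * a y by exact: dir_own_level.
have a0 y : A y -> 0 < a y.
  by move=> Ay; have := w0 nm Ay; rewrite wa // pmulr_rgt0 // w0.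
have Ca : Ck 1 A a by apply: (Ck_dir oA (Ce1 nm)); exact: Cu.
have C1 i : (i < n)%N -> Ck 1 A (w i) by move=> /Cw; exact: Ck_le.
rewrite (dir_ln _ (fun y Ay => w0 nm Ay) (C1 _ nm) Az).
rewrite (dir_ln _ (fun y Ay => w0 nm1 Ay) (C1 _ nm1) Az).
rewrite (dir_eq_on oA _ wa Az) (dirM _ (C1 _ nm1) Ca Az) -/a.
rewrite (wa z Az); have := w0 nm1 Az; have := a0 z Az.
move: (Gam m m j z) (w m.+1 z) (a z) (dir (e j z) a z) (dir (e j z) (w m.+1) z).
move=> C W a1 da dW a1p Wp; rewrite sub0r subr0 => E.
have a10 : a1 != 0 by rewrite gt_eqF.
have W0 : W != 0 by rewrite gt_eqF.
have CE : C = da / a1.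
  apply: (mulfI W0); apply: (mulfI a10).
  transitivity (- (W * a1 * - C)); first by ring.
  by rewrite E; field.
by rewrite CE; field; rewrite a10 W0.
Qed.

(** The divergence of e_m on the leaf tangent to e_m, e_{m+1}, and so on;
    it is the mean curvature in that leaf of the next one, whose normal is
    e_m. *)
Definition mean_curvature (m : nat) z : R := \sum_(j < n | (m < j)%N) Gam j m j z.

(** The divergence of Z_m = w_m e_m on its leaf, divided by w_m, as
    [divergence_weighted] shows. *)
Definition weighted_mean (m : nat) z : R := dir (e m z) (f m) z + mean_curvature m z.

(** The divergence of e_m in the ambient space exceeds its divergence on
    the leaf by the sum over j < m of Gamma_jmj = - Gamma_jjm. By
    [conn_shape] each of these is a difference of consecutive log-lengths
    differentiated along e_m, and the sum telescopes. *)
Lemma frame_div_level (m : nat) z : (m < n)%N -> A z ->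
  frame_div G e m z = weighted_mean m z - dir (e m z) (f 0%N) z.
Proof.
move=> mn Az.
rewrite (frame_divE sG onb (Ordinal mn) Az) /=.
rewrite (bigID (fun j : 'I_n => (m < j)%N)) /= -/(mean_curvature m z).
rewrite /weighted_mean.
suff -> : \sum_(i < n | ~~ (m < i)%N) Gam i m i z
   = dir (e m z) (f m) z - dir (e m z) (f 0%N) z.
  by rewrite addrCA addrA.
transitivity (\sum_(0 <= j < m) (dir (e m z) (f j.+1) z - dir (e m z) (f j) z));
  last by rewrite telescope_sumr.
rewrite big_mkord (big_ord_widen_cond n xpredT
  (fun j => dir (e m z) (f j.+1) z - dir (e m z) (f j) z)) ?(ltnW mn) //=.
rewrite [RHS]big_mkcond [LHS]big_mkcond /=; apply: eq_bigr => j _.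
rewrite -leqNgt leq_eqVlt; case: (ltngtP j m) => //= jm.
  rewrite -[LHS]opprK -(conn_anti oA sG uG CG Ce onb j j (Ordinal mn) Az) /=.
  by rewrite conn_shape // opprB.
rewrite jm; exact: (conn_diag oA sG uG CG Ce onb (Ordinal mn) (Ordinal mn) Az).
Qed.

Lemma log_length_C2 m : (m < n)%N -> Ck 2 A (f m).
Proof. by move=> mn; apply: (Ck_ln oA) => [z|]; [exact: w0|exact: Cw]. Qed.

Lemma weighted_mean_C1 m : (m < n)%N -> Ck 1 A (weighted_mean m).
Proof.
move=> mn; apply: (CkD oA); first exact: (Ck_dir oA (Ce1 mn) (log_length_C2 mn)).
apply: (Ck_sum oA) => j _.
exact: (conn_C1 oA uG CG Ce j (Ordinal mn) j).
Qed.

(** The identity in terms of the frame. Put a = e_{n-1} (f_{n-1}) and b =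
    e_{n-1} (f_0), where f_m is the logarithm of w_m. By [frame_div_level]
    the divergence of e_i at z is - e_i (f_0) for i < n-1, and a - b for i
    = n-1. Inserted in the formulas for the scalar curvature and for the
    Laplacian of w_0, these values leave an identity of polynomials. *)
Theorem frame_identity z : A z -> (0 < n)%N ->
  (forall m, (m < n.-1)%N -> weighted_mean m z = 0) ->
  2 * (w 0%N z)^-1 * laplacian G (w 0%N) z
  - 2 * dir (e n.-1 z) (fun y => dir (e n.-1 y) (f n.-1) y) z
  - 2 * \sum_(m < n.-1) dir (e m z) (weighted_mean m) z
  = scalar_curvature G z
    + \sum_(m < n) \sum_(i < n | (m <= i)%N) \sum_(j < n | (m <= j)%N) Gam i m j z ^+ 2
    + dir (e n.-1 z) (f n.-1) z ^+ 2
    + \sum_(i < n) dir (e i z) (f 0%N) z ^+ 2.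
Proof.
move=> Az n0 K0.
have flagA := flag_connection_trace (c := fun i j k => Gam i j k z)
  (fun i j k => conn_anti oA sG uG CG Ce onb i j k Az)
  (fun i j k ki kj => conn_flag ki kj (ltn_ord i) (ltn_ord j) Az).
rewrite -flagA (scalar_curvature_frame oA sG uG CG Ce onb Az).
rewrite (laplacian_frame oA sG uG Ce onb (Cw n0) Az).
set Q := \sum_(j < n) \sum_(i < n) _.
have Cf m : (m < n)%N -> Ck 1 A (f m) by move=> /log_length_C2; exact: Ck_le.
have Cdf (i m : nat) : (i < n)%N -> (m < n)%N ->
    Ck 1 A (fun y => dir (e i y) (f m) y).
  by move=> ni nm; exact: (Ck_dir oA (Ce1 ni) (log_length_C2 nm)).
have Cw1 m : (m < n)%N -> Ck 1 A (w m) by move=> /Cw; exact: Ck_le.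
(* The Laplacian of w_0 is rewritten in terms of its logarithm. *)
have wf v y : A y -> dir v (w 0%N) y = w 0%N y * dir v (f 0%N) y.
  move=> Ay; rewrite (dir_ln _ (fun x Ax => w0 n0 Ax) (Cw1 _ n0) Ay).
  by rewrite mulrA mulfV ?mul1r // gt_eqF ?w0.
pose b (i : nat) := dir (e i z) (f 0%N) z.
pose bb (i : nat) := dir (e i z) (fun y => dir (e i y) (f 0%N) y) z.
pose D (i : nat) := frame_div G e i z.
pose dK (i : nat) := dir (e i z) (weighted_mean i) z.
have lapE : (w 0%N z)^-1 * \sum_(i < n)
    (dir (e i z) (fun y => dir (e i y) (w 0%N) y) z + frame_div G e i z * dir (e i z) (w 0%N) z)
  = \sum_(i < n) (b i ^+ 2 + bb i + D i * b i).
  rewrite mulr_sumr; apply: eq_bigr => i _.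
  rewrite (dir_eq_on oA (e i z) (fun y Ay => wf (e i y) y Ay) Az).
  rewrite (dirM _ (Cw1 _ n0) (Cdf i _ (ltn_ord i) n0) Az) !wf // -/(b i) -/(bb i) -/(D i).
  by field; rewrite gt_eqF ?w0.
have DE (i : nat) : (i < n)%N -> D i = weighted_mean i z - b i.
  by move=> ni; exact: frame_div_level.
have dDE (i : nat) : (i < n)%N -> dir (e i z) (frame_div G e i) z = dK i - bb i.
  move=> ni; rewrite (dir_eq_on oA (e i z) (fun y Ay => frame_div_level ni Ay) Az).
  by rewrite (dirB oA _ (weighted_mean_C1 ni) (Cdf i 0%N ni n0) Az).
rewrite -mulrA lapE.
have -> : \sum_(i < n) dir (e i z) (frame_div G e i) z = \sum_(i < n) (dK i - bb i).
  by apply: eq_bigr => i _; exact: dDE.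
have nn : n = n.-1.+1 by rewrite prednK.
have n1 : (n.-1 < n)%N by rewrite {2}nn.
(* The last leaf is a curve, so there is no mean curvature term. *)
have lastK : weighted_mean n.-1 =1 (fun y => dir (e n.-1 y) (f n.-1) y).
  move=> y; rewrite /weighted_mean /mean_curvature big1 ?addr0 // => j.
  by rewrite ltnNge -ltnS -nn ltn_ord.
have dKl : dir (e n.-1 z) (fun y => dir (e n.-1 y) (f n.-1) y) z = dK n.-1.
  by rewrite /dK (funext lastK).
rewrite dKl.
pose a := dir (e n.-1 z) (f n.-1) z.
have Dl : D n.-1 = a - b n.-1 by rewrite DE // lastK.
have Di (i : nat) : (i < n.-1)%N -> D i = - b i.
  by move=> ni; rewrite DE ?K0 ?add0r // (ltn_trans ni).
have recr (F : nat -> R) : \sum_(i < n) F i = \sum_(i < n.-1) F i + F n.-1.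
  by rewrite -!(big_mkord xpredT) {1}nn big_nat_recr.
rewrite (recr (fun i => b i ^+ 2 + bb i + D i * b i)) (recr (fun i => dK i - bb i)).
rewrite (recr (fun i => frame_div G e i z ^+ 2)) (recr (fun i => b i ^+ 2)) -/a.
have -> : \sum_(i < n.-1) (b i ^+ 2 + bb i + D i * b i) = \sum_(i < n.-1) bb i.
  apply: eq_bigr => i _; rewrite Di //.
  by move: (b i) (bb i) => x1 x2; ring.
have -> : \sum_(i < n.-1) frame_div G e i z ^+ 2 = \sum_(i < n.-1) b i ^+ 2.
  by apply: eq_bigr => i _; rewrite -/(D i) Di // sqrrN.
rewrite sumrB -/(D n.-1) Dl.
move: (\sum_(i < n.-1) bb i) (\sum_(i < n.-1) dK i) (\sum_(i < n.-1) b i ^+ 2).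
move: (dK n.-1) (bb n.-1) (b n.-1) (a) (Q) => dk bbl bl a' Q' S1 S2 S3.
by ring.
Qed.

End LevelFrame.

(** * Immersed submanifolds *)

Section Immersion.
Variables (R : realType) (n d : nat) (G : 'rV[R]_n -> 'M[R]_n).
Variables (A : set 'rV[R]_n).
Hypotheses (oA : open A) (sG : forall z, A z -> (G z)^T = G z)
  (uG : forall z, A z -> G z \in unitmx) (CG : mxCk 2 A G).
Variables (B : set 'rV[R]_d) (Phi : 'rV[R]_d -> 'rV[R]_n).
Hypotheses (oB : open B) (CPhi : Ck 2 B Phi) (PhiA : forall y, B y -> A (Phi y)).
Variable (h : 'rV[R]_d -> 'M[R]_d).
Hypothesis hE : forall y, B y ->
  h y = 'J Phi y *m G (Phi y) *m ('J Phi y)^T.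
Hypothesis uh : forall y, B y -> h y \in unitmx.
Implicit Types (y : 'rV[R]_d) (a b c : 'I_d) (k : 'I_n).

Let E y := 'J Phi y.
Let CPhi1 : Ck 1 B Phi. Proof. exact: Ck_leS. Qed.

Lemma Ck_comp (r : nat) (f : 'rV[R]_n -> R) :
  (r <= 2)%N -> Ck r A f -> Ck r B (f \o Phi).
Proof.
elim: r f => [|r IH] f r2 Cf.
  split=> // y By; apply: continuous_comp; first exact: Ck_continuous CPhi By.
  exact: Ck_continuous Cf (PhiA By).
have Cf1 : Ck 1 A f by exact: Ck_le Cf.
split=> [y By|a].
  apply: continuous_comp; first exact: Ck_continuous CPhi By.
  exact: Ck_continuous Cf (PhiA By).
split=> [y By|].
  have [dc _] := partial_comp oB CPhi1 a oA Cf1 By (PhiA By).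
  exact: diff_derivable.
have C : Ck r B (fun y => \sum_k partial a (fun x => Phi x 0 k) y * (partial k f \o Phi) y).
  apply: (Ck_sum oB) => k _; apply: (CkM oB).
    apply: (@Ck_partial _ _ _ r B (fun x => Phi x 0 k) a).
    by apply: (Ck_coord _ _ oB); exact: Ck_le CPhi.
  apply: IH; first exact: ltnW.
  exact: Ck_partial.
apply: (Ck_eq_on oB) C => y By.
have [_ ->] := partial_comp oB CPhi1 a oA Cf1 By (PhiA By).
by apply: eq_bigr => k _; rewrite (jacobianE oB CPhi1 _ _ By).
Qed.

Lemma mxCk_comp (r p q : nat) (M : 'rV[R]_n -> 'M[R]_(p, q)) :
  (r <= 2)%N -> mxCk r A M -> mxCk r B (fun y => M (Phi y)).
Proof. by move=> r2 CM i j; exact: Ck_comp (CM i j). Qed.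

Lemma jacobian_C1 : mxCk 1 B E.
Proof.
move=> a k.
have C : Ck 1 B (partial a (fun x => Phi x 0 k)).
  by apply: Ck_partial; exact: (Ck_coord _ _ oB CPhi).
by apply: (Ck_eq_on oB) C => y By; rewrite /E (jacobianE oB CPhi1 _ _ By).
Qed.

Lemma mpartial_comp (p q : nat) (M : 'rV[R]_n -> 'M[R]_(p, q)) a y :
  mxCk 1 A M -> B y ->
  mpartial a (fun x => M (Phi x)) y = \sum_k E y a k *: mpartial k M (Phi y).
Proof.
move=> CM By; apply/matrixP => i j; rewrite [LHS]mxE summxE.
have [_ H] := partial_comp oB CPhi1 a oA (CM i j) By (PhiA By).
rewrite [LHS]H; apply: eq_bigr => k _.
by rewrite [RHS]mxE [X in _ = _ * X]mxE.
Qed.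

(** Row b is the derivative along the a-th coordinate of the b-th tangent
    vector, a second derivative of the immersion. *)
Lemma hessianC a b y : B y -> row b (mpartial a E y) = row a (mpartial b E y).
Proof.
move=> By; apply/rowP => k; rewrite [LHS]mxE [LHS]mxE [RHS]mxE [RHS]mxE.
have P a' b' : partial a' (fun x => E x b' k) y
    = partial a' (partial b' (fun x => Phi x 0 k)) y.
  by apply: (partial_eq_on _ oB) => // x Bx; rewrite /E (jacobianE oB CPhi1 _ _ Bx).
apply: (etrans (P a b)); apply: (etrans _ (esym (P b a))).
exact: (partialC _ _ oB (Ck_coord _ _ oB CPhi) By).
Qed.

Let Ca a y : 'M[R]_n := \sum_k E y a k *: chrmx G k (Phi y).
Let W a y : 'M[R]_(d, n) := mpartial a E y + E y *m Ca a y.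
Let K a y : 'M[R]_d := W a y *m G (Phi y) *m (E y)^T.

Lemma second_formC a b y : B y -> row b (W a y) = row a (W b y).
Proof.
move=> By; rewrite !linearD /= (hessianC _ _ By); congr (_ + _).
rewrite !row_mul /Ca; apply/rowP => j.
transitivity (\sum_k \sum_l E y a k * E y b l * chrmx G k (Phi y) l j).
  rewrite mxE exchange_big; apply: eq_bigr => l _ /=.
  rewrite summxE mulr_sumr; apply: eq_bigr => k _.
  by rewrite [row _ _ _ _]mxE [X in _ * X]mxE mulrCA mulrA.
rewrite mxE; apply: eq_bigr => k _.
rewrite summxE mulr_sumr; apply: eq_bigr => l _.
rewrite [row _ _ _ _]mxE [X in _ = _ * X]mxE (chrmxC oA sG k l j (PhiA By)).
by rewrite mulrA.
Qed.

Lemma mpartial_pullback a y : B y -> mpartial a h y = K a y + (K a y)^T.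
Proof.
move=> By.
have CE := jacobian_C1.
have CG' : mxCk 1 B (fun x => G (Phi x)) by apply: mxCk_comp => //; exact: mxCk_le CG.
have -> : mpartial a h y = mpartial a (fun x => E x *m G (Phi x) *m (E x)^T) y.
  exact: (mpartial_eq_on oB).
have CEG := mxCk_mul oB CE CG'.
rewrite (mpartialM _ CEG (mxCk_tr oB CE) By) (mpartialM _ CE CG' By) mpartial_tr.
rewrite (mpartial_comp _ (mxCk_le (leqnSn 1) CG) By).
have -> : \sum_k E y a k *: mpartial k G (Phi y)
   = Ca a y *m G (Phi y) + (Ca a y *m G (Phi y))^T.
  rewrite /Ca mulmx_suml linear_sum -big_split; apply: eq_bigr => k _ /=.
  rewrite (metric_parallel oA sG uG _ (PhiA By)) scalerDr -scalemxAl.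
  by rewrite [in RHS]linearZ.
rewrite /K /W !trmx_mul trmxK (sG (PhiA By)).
move: (mpartial a E y) (E y) (G (Phi y)) (Ca a y) => dE Ey Gy Cy.
rewrite [(_ + _)^T]linearD /= trmx_mul !(mulmxDl, mulmxDr) !mulmxA -!addrA; congr (_ + (_ + _)).
by rewrite addrC.
Qed.

Lemma h_sym y : B y -> (h y)^T = h y.
Proof.
by move=> By; rewrite hE // !trmx_mul trmxK (sG (PhiA By)) mulmxA.
Qed.

(** Gauss's formula for the coordinate fields. Let K_abc be the entries on
    the right: the derivative of the induced metric is K plus its
    transpose in b and c, and K is symmetric in a and b. Koszul's formula
    then isolates K_abc, as in the proof that the Levi-Civita connection
    is unique. *)
Lemma chrmx_pullback a y : B y -> chrmx h a y *m h y = K a y.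
Proof.
move=> By; apply/matrixP => b c.
rewrite (chrmx_lower h_sym uh _ _ _ By).
have dh i j l : partial i (fun x => h x j l) y = K i y j l + K i y l j.
  have -> : partial i (fun x => h x j l) y = mpartial i h y j l by rewrite [RHS]mxE.
  by rewrite mpartial_pullback // [LHS]mxE; congr (_ + _); rewrite mxE.
have KC i j l : K i y j l = K j y i l.
  have rowK i' j' : K i' y j' l = (row j' (W i' y) *m G (Phi y) *m (E y)^T) 0 l.
    by rewrite -!row_mul [RHS]mxE.
  by rewrite !rowK second_formC.
rewrite !dh (KC b a c) (KC c a b) (KC c b a).
move: (K a y b c) (K a y c b) (K b y c a) => p q r.
by field.
Qed.

(** Gauss's formula: the covariant derivative of a submanifold is the
    tangential part of the ambient one. Both sides are paired with the
    coordinate fields of the submanifold. *)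
Lemma tangential_nabla (Y : 'rV[R]_n -> 'rV[R]_n) (ty : 'rV[R]_d -> 'rV[R]_d) y :
  mxCk 1 A Y -> mxCk 1 B ty -> (forall x, B x -> ty x *m E x = Y (Phi x)) ->
  B y ->
  nabla h ty y *m h y = E y *m nabla G Y (Phi y) *m G (Phi y) *m (E y)^T.
Proof.
move=> CY Ct tyE By; apply/row_matrixP => a.
rewrite !row_mul nabla_row mulmxDl -[ty y *m _ *m _]mulmxA chrmx_pullback //.
rewrite hE // -/(E y) /K !mulmxA -!mulmxDl; congr (_ *m _ *m _).
rewrite /W mulmxDr mulmxA (tyE y By).
have D : mpartial a (fun x => ty x *m E x) y = mpartial a (fun x => Y (Phi x)) y.
  exact: (mpartial_eq_on oB).
rewrite (mpartialM _ Ct jacobian_C1 By) (mpartial_comp _ CY By) in D.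
rewrite addrA D /Ca mulmx_sumr -big_split mulmx_sum_row.
apply: eq_bigr => k _ /=; rewrite nabla_row scalerDr -scalemxAr.
by rewrite [row a (E y) 0 k]mxE.
Qed.

(** The components of a tangent field are recovered from it by means of
    the inverse of the induced metric, and so inherit its regularity. *)
Lemma tangent_C1 (Y : 'rV[R]_n -> 'rV[R]_n) (ty : 'rV[R]_d -> 'rV[R]_d) :
  mxCk 1 A Y -> (forall x, B x -> ty x *m E x = Y (Phi x)) -> mxCk 1 B ty.
Proof.
move=> CY tyE.
have CE := jacobian_C1.
have CG' : mxCk 1 B (fun x => G (Phi x)) by apply: mxCk_comp => //; exact: mxCk_le CG.
have CGE := mxCk_mul oB CG' (mxCk_tr oB CE).
have CY' : mxCk 1 B (fun x => Y (Phi x)) by exact: mxCk_comp.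
have Ch : mxCk 1 B h.
  apply: (mxCk_eq_on oB) (mxCk_mul oB CE CGE) => x Bx.
  by rewrite hE // mulmxA.
have Chi := mxCk_inv oB uh Ch.
apply: (mxCk_eq_on oB) (mxCk_mul oB (mxCk_mul oB CY' CGE) Chi) => x Bx.
by rewrite -tyE // -(mulmxA (ty x)) (mulmxA (E x)) -hE // mulmxK ?uh.
Qed.

Lemma inner_pullback v v' y : B y ->
  inner (h y) v v' = inner (G (Phi y)) (v *m E y) (v' *m E y).
Proof. by move=> By; rewrite /inner hE // -/(E y) trmx_mul !mulmxA. Qed.

End Immersion.

Section FramedImmersion.
Variables (R : realType) (n m : nat) (G : 'rV[R]_n -> 'M[R]_n).
Variables (A : set 'rV[R]_n).
Hypotheses (oA : open A) (sG : forall z, A z -> (G z)^T = G z)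
  (uG : forall z, A z -> G z \in unitmx) (CG : mxCk 2 A G).
Variable (e : nat -> 'rV[R]_n -> 'rV[R]_n).
Hypothesis Ce : forall i, (i < n)%N -> mxCk 2 A (e i).
Hypothesis onb : forall z i j, A z -> (i < n)%N -> (j < n)%N ->
  inner (G z) (e i z) (e j z) = (i == j)%:R.
Let d := (n - m)%N.
Variables (B : set 'rV[R]_d) (Phi : 'rV[R]_d -> 'rV[R]_n).
Hypotheses (oB : open B) (CPhi : Ck 2 B Phi) (PhiA : forall y, B y -> A (Phi y)).
Variable (h : 'rV[R]_d -> 'M[R]_d).
Hypothesis hE : forall y, B y ->
  h y = 'J Phi y *m G (Phi y) *m ('J Phi y)^T.
Hypothesis immersive : forall y, B y -> row_free ('J Phi y).
Hypothesis leaf : forall y (a : 'I_d) k, B y -> (k < m)%N ->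
  inner (G (Phi y)) (row a ('J Phi y)) (e k (Phi y)) = 0.
Implicit Types (y : 'rV[R]_d).

Let E y := 'J Phi y.
Let F y : 'M[R]_(d, n) := \matrix_b e (b + m)%N (Phi y).
Let S y : 'M[R]_d := E y *m G (Phi y) *m (F y)^T.

(** Tangent frame vectors are counted from 0 in the coordinates of the
    leaf, and from m in the ambient frame. *)
Lemma sum_leaf (V : zmodType) (X : nat -> V) :
  \sum_(b < d) X (b + m)%N = \sum_(i < n | (m <= i)%N) X i.
Proof.
rewrite -(big_mkord xpredT (fun b => X (b + m)%N)) /d -(big_addn 0 n m xpredT X).
by rewrite add0n big_geq_mkord.
Qed.

Let innerE_row y (M : 'M[R]_(d, n)) (N : 'M[R]_n) (a b : 'I_d) :
  (M *m N *m (F y)^T) a b = inner N (row a M) (e (b + m)%N (Phi y)).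
Proof.
rewrite /inner -row_mul [LHS]mxE [RHS]mxE; apply: eq_bigr => k _.
by rewrite [row _ _ _ _]mxE [X in _ * X]mxE [F y b k]mxE [X in _ = _ * X]mxE.
Qed.

(** The coordinate fields of the leaf are orthogonal to the first m frame
    vectors, hence combinations of the others. *)
Lemma leaf_decomposition y : B y -> E y = S y *m F y.
Proof.
move=> By; apply/row_matrixP => a; rewrite row_mul mulmx_sum_row.
rewrite [LHS](frame_expansion sG onb _ (PhiA By)).
rewrite (bigID (fun i : 'I_n => (m <= i)%N)) /= [X in _ + X]big1 ?addr0; last first.
  by move=> i; rewrite -ltnNge => im; rewrite leaf // scale0r.
rewrite -(sum_leaf (fun i => inner (G (Phi y)) (row a (E y)) (e i (Phi y)) *: e i (Phi y))).
apply: eq_bigr => b _; rewrite rowK; congr (_ *: _).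
by rewrite [RHS]mxE /S innerE_row.
Qed.

Lemma leaf_coord_unit y : B y -> S y \in unitmx.
Proof.
move=> By; rewrite -row_free_unit -kermx_eq0; have := immersive By.
rewrite -/(E y) (leaf_decomposition By) -!kermx_eq0 => /eqP K0.
apply/eqP; apply/row_matrixP => i.
have : row i (kermx (S y)) *m (S y *m F y) = 0.
  by rewrite mulmxA -row_mul mulmx_ker row0 mul0mx.
by move/sub_kermxP; rewrite K0 submx0 => /eqP ->; rewrite row0.
Qed.

Lemma induced_metricE y : B y -> h y = S y *m (S y)^T.
Proof.
move=> By; rewrite hE // -/(E y) {2}(leaf_decomposition By) trmx_mul.
by rewrite mulmxA /S.
Qed.

Lemma induced_metric_unit y : B y -> h y \in unitmx.
Proof.
move=> By; rewrite (induced_metricE By) unitmx_mul unitmx_tr.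
by rewrite leaf_coord_unit.
Qed.

(** The inverse of the induced metric, pushed forward, is the sum of the
    squares of the tangent frame vectors. Through it all traces on the
    leaf become sums over the frame. *)
Lemma leaf_projection y : B y ->
  (E y)^T *m invmx (h y) *m E y = (F y)^T *m F y.
Proof.
move=> By; have uS := leaf_coord_unit By.
have uSt : (S y)^T \in unitmx by rewrite unitmx_tr.
rewrite (leaf_decomposition By) trmx_mul.
have -> : invmx (h y) = invmx (S y)^T *m invmx (S y).
  apply: (can_inj (mulKmx (induced_metric_unit By))).
  rewrite mulmxV ?induced_metric_unit // induced_metricE // mulmxA.
  by rewrite -(mulmxA (S y)) mulmxV // mulmx1 mulmxV.
move: (S y) (F y) uS uSt => S0 F0 uS uSt.
by rewrite !mulmxA mulmxK // mulmxKV.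
Qed.

Lemma leaf_span y v : B y -> (forall k, (k < m)%N -> inner (G (Phi y)) v (e k (Phi y)) = 0) ->
  (v <= E y)%MS.
Proof.
move=> By vt; have uS := leaf_coord_unit By.
have -> : v = v *m G (Phi y) *m (F y)^T *m F y.
  rewrite [LHS](frame_expansion sG onb _ (PhiA By)) mulmx_sum_row.
  rewrite (bigID (fun i : 'I_n => (m <= i)%N)) /= [X in _ + X]big1 ?addr0; last first.
    by move=> i; rewrite -ltnNge => im; rewrite vt // scale0r.
  rewrite -(sum_leaf (fun i => inner (G (Phi y)) v (e i (Phi y)) *: e i (Phi y))).
  apply: eq_bigr => b _; rewrite rowK; congr (_ *: _).
  rewrite /inner [LHS]mxE [RHS]mxE; apply: eq_bigr => k _.
  by rewrite [X in _ * X]mxE [X in _ = _ * X]mxE [F y b k]mxE.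
have FE : F y = invmx (S y) *m E y by rewrite (leaf_decomposition By) mulKmx.
by rewrite [X in (_ *m X <= _)%MS]FE mulmxA submxMl.
Qed.

Section TangentField.
Variables (Y : 'rV[R]_n -> 'rV[R]_n) (ty : 'rV[R]_d -> 'rV[R]_d).
Hypotheses (CY : mxCk 1 A Y) (tyE : forall x, B x -> ty x *m E x = Y (Phi x)).

Let Cty : mxCk 1 B ty.
Proof. exact: (tangent_C1 oA CG oB CPhi PhiA hE induced_metric_unit CY tyE). Qed.

Let NE y : B y ->
  nabla h ty y *m h y = E y *m nabla G Y (Phi y) *m G (Phi y) *m (E y)^T.
Proof.
exact: (tangential_nabla oA sG uG CG oB CPhi PhiA hE induced_metric_unit CY Cty tyE).
Qed.

Let N2 y : B y -> nabla h ty y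
  = E y *m nabla G Y (Phi y) *m G (Phi y) *m (E y)^T *m invmx (h y).
Proof. by move=> By; rewrite -NE // mulmxK // induced_metric_unit. Qed.

(** Gauss's formula [tangential_nabla] gives the lowered entries of the
    intrinsic derivative, and [leaf_projection] removes the inverse of the
    induced metric from their trace. *)
Lemma divergence_leaf y : B y ->
  divergence h ty y
  = \sum_(j < n | (m <= j)%N)
      inner (G (Phi y)) (e j (Phi y) *m nabla G Y (Phi y)) (e j (Phi y)).
Proof.
move=> By; rewrite divergence_trace N2 //.
set N := nabla G Y (Phi y); set g := G (Phi y).
transitivity (\tr (F y *m N *m g *m (F y)^T)).
  transitivity (\tr (N *m g *m ((E y)^T *m invmx (h y) *m E y))).
    by rewrite -!mulmxA mxtrace_mulC !mulmxA.
  by rewrite leaf_projection // -!mulmxA [RHS]mxtrace_mulC !mulmxA.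
rewrite -(sum_leaf (fun j => inner g (e j (Phi y) *m N) (e j (Phi y)))).
by apply: eq_bigr => b _; rewrite innerE_row row_mul rowK.
Qed.

Lemma covariant_sqnorm_leaf y : B y ->
  covariant_sqnorm h ty y
  = \sum_(i < n | (m <= i)%N) \sum_(j < n | (m <= j)%N)
      inner (G (Phi y)) (e i (Phi y) *m nabla G Y (Phi y)) (e j (Phi y)) ^+ 2.
Proof.
move=> By.
set N := nabla G Y (Phi y); set g := G (Phi y).
have sg : g^T = g by exact: sG (PhiA By).
have sh : (h y)^T = h y by rewrite (h_sym sG PhiA hE By).
pose C := nabla h ty y.
have rowC a : covariant h ty a y = row a C.
  by apply/rowP => k; rewrite [RHS]mxE [RHS]mxE.
transitivity (\tr (invmx (h y) *m (C *m h y *m C^T))).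
  rewrite /mxtrace; apply: eq_bigr => a _.
  rewrite [RHS]mxE; apply: eq_bigr => b _; congr (_ * _).
  rewrite (innerC _ _ sh) !rowC /inner.
  have -> : (C *m h y *m C^T) b a = row b (C *m h y *m C^T) 0 a by rewrite [RHS]mxE.
  rewrite !row_mul [LHS]mxE [RHS]mxE; apply: eq_bigr => k _; congr (_ * _).
  by rewrite [LHS]mxE [LHS]mxE [RHS]mxE.
pose X := F y *m N *m g *m (F y)^T.
transitivity (\tr (X *m X^T)).
  have CT : C^T = invmx (h y) *m (E y *m g *m N^T *m (E y)^T).
    rewrite /C N2 // trmx_mul trmx_inv sh; congr (_ *m _).
    by rewrite !trmx_mul trmxK sg !mulmxA.
  rewrite CT /C NE // -/N -/g.
  pose P := (E y)^T *m invmx (h y) *m E y.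
  transitivity (\tr (P *m (N *m g *m P *m g *m N^T))).
    by rewrite /P -!mulmxA [RHS]mxtrace_mulC !mulmxA.
  rewrite /P leaf_projection // -!mulmxA [LHS]mxtrace_mulC.
  by rewrite /X !trmx_mul trmxK sg !mulmxA.
rewrite -(sum_leaf (fun i => \sum_(j < n | (m <= j)%N)
   inner g (e i (Phi y) *m N) (e j (Phi y)) ^+ 2)).
apply: eq_bigr => a _; rewrite mxE.
rewrite -(sum_leaf (fun j => inner g (e (a + m)%N (Phi y) *m N) (e j (Phi y)) ^+ 2)).
apply: eq_bigr => b _.
by rewrite [X^T b a]mxE -expr2 /X innerE_row row_mul rowK.
Qed.

End TangentField.

(** By [leaf_projection], only the tangent frame vectors remain of the
    ambient gradient. *)
Lemma gradient_leaf (f : 'rV[R]_n -> R) (phi : 'rV[R]_d -> R) y :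
  Ck 1 A f -> (forall x, B x -> phi x = f (Phi x)) -> B y ->
  gradient h phi y *m E y
  = \sum_(i < n | (m <= i)%N) dir (e i (Phi y)) f (Phi y) *: e i (Phi y).
Proof.
move=> Cf phiE By.
have sh : (h y)^T = h y by rewrite (h_sym sG PhiA hE By).
pose Df : 'rV[R]_n := \row_k partial k f (Phi y).
have -> : gradient h phi y = Df *m (E y)^T *m invmx (h y).
  apply/rowP => a; rewrite mxE [RHS]mxE; apply: eq_bigr => b _.
  rewrite mulrC; congr (_ * _); last by rewrite /metric_inv -[in LHS]sh -trmx_inv mxE.
  have -> : partial b phi y = partial b (f \o Phi) y.
    by apply: (partial_eq_on _ oB).
  have [_ ->] := partial_comp oB (Ck_leS CPhi) b oA Cf By (PhiA By).
  by rewrite mxE; apply: eq_bigr => k _; rewrite mulrC !mxE.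
rewrite -!mulmxA (mulmxA (E y)^T) leaf_projection // mulmxA mulmx_sum_row.
rewrite -(sum_leaf (fun i => dir (e i (Phi y)) f (Phi y) *: e i (Phi y))).
apply: eq_bigr => b _; rewrite rowK; congr (_ *: _).
by rewrite mxE; apply: eq_bigr => k _; rewrite mulrC [X in X * _]mxE [F y b k]mxE [X in _ * X]mxE.
Qed.

End FramedImmersion.

(** * The frame adapted to the level sets *)

Section LevelFrameExistence.
Variables (R : realType) (n : nat) (G : 'rV[R]_n -> 'M[R]_n).
Variables (A : set 'rV[R]_n).
Hypotheses (oA : open A) (sG : forall z, A z -> (G z)^T = G z)
  (pG : forall z v, A z -> v != 0 -> 0 < inner (G z) v v) (CG : mxCk 2 A G).
Variables (u : nat -> 'rV[R]_n -> R) (Z : nat -> 'rV[R]_n -> 'rV[R]_n).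
Let w m z := vlength (G z) (Z m z).
Hypothesis n0 : (0 < n)%N.
Hypothesis CZ : forall m, (m < n)%N -> mxCk 2 A (Z m).
Hypothesis Z0 : forall m z, (m < n)%N -> A z -> Z m z != 0.
Hypothesis Ztangent : forall m l z, (l < m)%N -> (m < n.-1)%N -> A z ->
  dir (Z m z) (u l) z = 0.
Hypothesis Zgradient : forall m z v, (m < n.-1)%N -> A z ->
  (forall l, (l < m)%N -> dir v (u l) z = 0) ->
  inner (G z) (Z m z) v = w m.+1 z * dir v (u m) z.
Implicit Types (z v : 'rV[R]_n).

Lemma pos_unitmx z : A z -> G z \in unitmx.
Proof.
move=> Az; rewrite -row_free_unit -kermx_eq0; apply/eqP/row_matrixP => i.
rewrite row0; apply/eqP/negP => /negP /(pG Az).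
by rewrite /inner -row_mul mulmx_ker row0 mul0mx mxE ltxx.
Qed.

Lemma length_gt0 m z : (m < n)%N -> A z -> 0 < w m z.
Proof. by move=> mn Az; rewrite sqrtr_gt0 pG // Z0. Qed.

Lemma length_sqr m z : (m < n)%N -> A z -> w m z ^+ 2 = inner (G z) (Z m z) (Z m z).
Proof. by move=> mn Az; rewrite sqr_sqrtr // ltW // pG // Z0. Qed.

Lemma inner_Ck (X Y : 'rV[R]_n -> 'rV[R]_n) :
  mxCk 2 A X -> mxCk 2 A Y -> Ck 2 A (fun z => inner (G z) (X z) (Y z)).
Proof.
move=> CX CY; exact: (mxCk_mul oA (mxCk_mul oA CX CG) (mxCk_tr oA CY)).
Qed.

Lemma length_Ck m : (m < n)%N -> Ck 2 A (w m).
Proof.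
move=> mn; apply: (Ck_sqrt oA) => [z Az|]; first by rewrite pG // Z0.
by apply: inner_Ck; exact: CZ.
Qed.

Let e0 m z := (w m z)^-1 *: Z m z.

Let pred_lt m : (m < n.-1)%N -> (m < n)%N.
Proof. by move=> mn; rewrite (leq_trans mn) ?leq_pred. Qed.

Let Ce0 m : (m < n)%N -> mxCk 2 A (e0 m).
Proof.
move=> mn; apply: (mxCk_scale oA); last exact: CZ.
apply: (Ck_inv oA); last exact: length_Ck.
by move=> z Az; rewrite gt_eqF // length_gt0.
Qed.

Let e0_tangent m l z : (l < m)%N -> (m < n.-1)%N -> A z ->
  dir (e0 m z) (u l) z = 0.
Proof.
move=> lm mn Az; rewrite /e0 -[_ *: _]addr0 dir_linear Ztangent // mulr0 add0r.
by rewrite /dir big1 // => i _; rewrite mxE mul0r.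
Qed.

Let e0_gradient m z v : (m < n.-1)%N -> A z ->
  (forall l, (l < m)%N -> dir v (u l) z = 0) ->
  w m z * inner (G z) (e0 m z) v = w m.+1 z * dir v (u m) z.
Proof.
move=> mn Az vt; rewrite /e0 innerZl mulrA mulfV ?mul1r.
  exact: Zgradient.
by rewrite gt_eqF // length_gt0 // pred_lt.
Qed.

Let inv2 (a : R) : a != 0 -> a^-1 * (a^-1 * a ^+ 2) = 1.
Proof. by move=> a0; field. Qed.

Let e0_orthonormal i j z : A z -> (i < n.-1)%N -> (j < n.-1)%N ->
  inner (G z) (e0 i z) (e0 j z) = (i == j)%:R.
Proof.
move=> Az ni nj.
have off k l : (k < l)%N -> (k < n.-1)%N -> (l < n.-1)%N ->
    inner (G z) (e0 k z) (e0 l z) = 0.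
  move=> kl nk nl; have wk0 : w k z != 0 by rewrite gt_eqF // length_gt0 // pred_lt.
  apply: (mulfI wk0); rewrite e0_gradient // => [|r rk].
    by rewrite e0_tangent // !mulr0.
  by rewrite e0_tangent // (ltn_trans rk).
case: (ltngtP i j) => [ij|ji|->]; first exact: off.
  by rewrite innerC ?sG // off.
rewrite innerZl innerZr -length_sqr ?pred_lt //; apply: inv2.
by rewrite gt_eqF // length_gt0 // pred_lt.
Qed.

Lemma positive_set_open (f : 'rV[R]_n -> R) : Ck 0 A f -> open (A `&` [set z | 0 < f z]).
Proof.
move=> Cf; rewrite openE => z [Az fz]; apply: filterI; first exact: near_open.
have := Ck_continuous Cf Az => /cvgr_gt/(_ _ fz); apply: filterS => y.
by [].
Qed.

(** The normalised fields Z_m are orthonormal: each is proportional to the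
    level gradient of u_m, and the later ones are tangent to the level
    sets of u_m. The last frame vector comes from a fixed vector,
    orthogonal at x to the others, by one step of the Gram-Schmidt
    process, and A' is the set where this step is possible. It is tangent
    to all level sets because it is orthogonal to all level gradients. *)
Lemma level_frame_exists x : A x ->
  exists (A' : set 'rV[R]_n) (e : nat -> 'rV[R]_n -> 'rV[R]_n),
  [/\ open A', A' x & A' `<=` A] /\
  [/\ forall i, (i < n)%N -> mxCk 2 A' (e i),
      forall z i j, A' z -> (i < n)%N -> (j < n)%N ->
        inner (G z) (e i z) (e j z) = (i == j)%:R,
      forall m z, (m < n.-1)%N -> e m z = (w m z)^-1 *: Z m z,
      forall m l z, (l < m)%N -> (m < n)%N -> A' z -> dir (e m z) (u l) z = 0
    & forall m z v, (m < n.-1)%N -> A' z ->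
        (forall l, (l < m)%N -> dir v (u l) z = 0) ->
        w m z * inner (G z) (e m z) v = w m.+1 z * dir v (u m) z].
Proof.
move=> Ax.
(* A linear system of n-1 equations in n unknowns. *)
have [v0 v00 vperp] : exists2 v0 : 'rV[R]_n, v0 != 0 &
    forall i, (i < n.-1)%N -> inner (G x) v0 (e0 i x) = 0.
  pose N : 'M[R]_(n, n.-1) := \matrix_(a, b) (G x *m (e0 b x)^T) a 0.
  have kN : kermx N != 0.
    rewrite kermx_eq0 /row_free neq_ltn (leq_ltn_trans (rank_leq_col N)) //.
    by rewrite prednK.
  have [i ki] : exists i, row i (kermx N) != 0.
    apply/existsP; apply: contraNT kN; rewrite negb_exists => /forallP H.
    by apply/eqP/row_matrixP => i; apply/eqP; have := H i; rewrite negbK row0.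
  exists (row i (kermx N)) => // b nb.
  have E : (row i (kermx N) *m N) 0 (Ordinal nb) = 0.
    by rewrite -row_mul mulmx_ker row0 mxE.
  rewrite -[RHS]E /inner -mulmxA [LHS]mxE [RHS]mxE.
  by apply: eq_bigr => k _; rewrite [X in _ = _ * X]mxE.
pose q z := v0 - \sum_(i < n.-1) inner (G z) v0 (e0 i z) *: e0 i z.
have Cq : mxCk 2 A q.
  apply: (mxCk_add oA); first exact: mxCk_cst.
  apply: (mxCk_opp oA); apply: (mxCk_sum oA) => i _.
  have Ci := Ce0 (pred_lt (ltn_ord i)).
  apply: (mxCk_scale oA) (Ci).
  have Cv : mxCk 2 A (fun=> v0) by move=> a b; exact: Ck_cst.
  exact: (inner_Ck Cv Ci).
pose r z := inner (G z) (q z) (q z).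
have Cr : Ck 2 A r by exact: inner_Ck.
have qx : q x = v0.
  by rewrite /q big1 ?subr0 // => i _; rewrite vperp // scale0r.
pose A' := A `&` [set z | 0 < r z].
have A'A : A' `<=` A by move=> z [].
have qperp z i : A z -> (i < n.-1)%N -> inner (G z) (q z) (e0 i z) = 0.
  move=> Az ni; rewrite /q -scaleN1r innerDl innerZl inner_suml mulN1r.
  rewrite (bigD1 (Ordinal ni)) //= innerZl e0_orthonormal // eqxx mulr1.
  rewrite big1 ?addr0 ?subrr // => j ji; rewrite innerZl e0_orthonormal //.
  by rewrite (_ : (j == i :> nat) = false) ?mulr0 //; exact: negbTE.
pose e m z := if (m < n.-1)%N then e0 m z else (Num.sqrt (r z))^-1 *: q z.
have lastE m : (m < n)%N -> ~~ (m < n.-1)%N -> m = n.-1.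
  move=> mn; rewrite -leqNgt => nm; apply/eqP; rewrite eqn_leq nm andbT.
  by rewrite -ltnS prednK.
have onb z i j : A' z -> (i < n)%N -> (j < n)%N ->
    inner (G z) (e i z) (e j z) = (i == j)%:R.
  move=> [Az rz] ni nj; rewrite /e.
  case: ifPn => ni'; case: ifPn => nj'.
  - exact: e0_orthonormal.
  - rewrite innerZr (innerC _ _ (sG Az)) qperp // mulr0.
    by rewrite (_ : (i == j) = false) //; apply/negbTE; apply: contraNneq nj' => <-.
  - rewrite innerZl qperp // mulr0.
    by rewrite (_ : (i == j) = false) //; apply/negbTE; apply: contraNneq ni' => ->.
  have sr : Num.sqrt (r z) ^+ 2 = r z by rewrite sqr_sqrtr // ltW.
  rewrite innerZl innerZr -/(r z) -{3}sr (lastE _ ni ni') (lastE _ nj nj') eqxx.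
  by apply: inv2; rewrite gt_eqF // sqrtr_gt0.
have grad m z v : (m < n.-1)%N -> A' z ->
    (forall l, (l < m)%N -> dir v (u l) z = 0) ->
    w m z * inner (G z) (e m z) v = w m.+1 z * dir v (u m) z.
  by move=> mn [Az _] vt; rewrite /e mn; exact: e0_gradient.
exists A', e; split; first split=> //.
- by apply: positive_set_open; exact: Ck_le Cr.
- by split=> //; rewrite /= /r qx pG.
split=> //.
- move=> m mn; case: (boolP (m < n.-1)%N) => mn'.
    apply: (@mxCk_eq_on _ _ A' _ _ _ _ (e0 m)).
    + by apply: positive_set_open; exact: Ck_le Cr.
    + by move=> z _; rewrite /e mn'.
    + by move=> a b; apply: Ck_subset A'A _; exact: Ce0.
  have oA' : open A' by apply: positive_set_open; exact: Ck_le Cr.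
  apply: (@mxCk_eq_on _ _ A' _ _ _ _ (fun z => (Num.sqrt (r z))^-1 *: q z)) => //.
    by move=> z _; rewrite /e (negPf mn').
  apply: (mxCk_scale oA'); last by move=> a b; apply: Ck_subset A'A _; exact: Cq.
  apply: (Ck_inv oA') => [z [_ rz]|]; first by rewrite gt_eqF // sqrtr_gt0.
  by apply: (Ck_sqrt oA') => [z []//|]; exact: Ck_subset A'A _.
- by move=> m z mn; rewrite /e mn.
- move=> m l z lm mn A'z; have Az := A'A _ A'z.
  case: (boolP (m < n.-1)%N) => mn'; first by rewrite /e mn' e0_tangent.
  have -> : e m z = e n.-1 z by rewrite (lastE _ mn mn').
  have ln : (l < n.-1)%N by rewrite -(lastE _ mn mn').
  elim/ltn_ind: l {lm} ln => l IH ln.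
  have wl0 : w l.+1 z != 0.
    by rewrite gt_eqF // length_gt0 // -(prednK n0) ltnS.
  apply: (mulfI wl0); rewrite mulr0 -grad //.
    have n1 : (n.-1 < n)%N by rewrite prednK.
    rewrite (onb _ _ _ A'z (pred_lt ln) n1).
    by rewrite (_ : (l == n.-1) = false) ?mulr0 //; apply/negbTE; rewrite neq_ltn ln.
  by move=> k kl; apply: IH => //; exact: ltn_trans kl ln.
Qed.

End LevelFrameExistence.

(** * Intrinsic quantities of the level sets *)

Section LeafOfFlag.
Variables (R : realType) (n : nat) (G : 'rV[R]_n -> 'M[R]_n).
Variables (A : set 'rV[R]_n).
Hypotheses (oA : open A) (sG : forall z, A z -> (G z)^T = G z)
  (uG : forall z, A z -> G z \in unitmx) (CG : mxCk 2 A G).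
Variable (e : nat -> 'rV[R]_n -> 'rV[R]_n).
Hypothesis Ce : forall i, (i < n)%N -> mxCk 2 A (e i).
Hypothesis onb : forall z i j, A z -> (i < n)%N -> (j < n)%N ->
  inner (G z) (e i z) (e j z) = (i == j)%:R.
Variables (u w : nat -> 'rV[R]_n -> R).
Hypothesis Cu : forall m, (m < n.-1)%N -> Ck 2 A (u m).
Hypothesis Cw : forall m, (m < n)%N -> Ck 2 A (w m).
Hypothesis w0 : forall m z, (m < n)%N -> A z -> 0 < w m z.
Hypothesis tangent : forall m l z, (l < m)%N -> (m < n)%N -> A z ->
  dir (e m z) (u l) z = 0.
Hypothesis level_gradient : forall m z v, (m < n.-1)%N -> A z ->
  (forall l, (l < m)%N -> dir v (u l) z = 0) ->
  w m z * inner (G z) (e m z) v = w m.+1 z * dir v (u m) z.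
Variable m : nat.
Hypothesis mn : (m < n)%N.
Variables (B : set 'rV[R]_(n - m)) (Phi : 'rV[R]_(n - m) -> 'rV[R]_n).
Hypotheses (oB : open B) (CPhi : Ck 2 B Phi) (PhiA : forall y, B y -> A (Phi y)).
Variable (h : 'rV[R]_(n - m) -> 'M[R]_(n - m)).
Hypothesis hE : forall y, B y ->
  h y = 'J Phi y *m G (Phi y) *m ('J Phi y)^T.
Hypothesis immersive : forall y, B y -> row_free ('J Phi y).
Hypothesis level : forall l y y', (l < m)%N -> B y -> B y' ->
  u l (Phi y) = u l (Phi y').
Implicit Types (y : 'rV[R]_(n - m)) (z : 'rV[R]_n).

Let CPhi1 : Ck 1 B Phi. Proof. exact: Ck_leS. Qed.
Let m_pred l : (l < m)%N -> (l < n.-1)%N.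
Proof.
by move=> lm; apply: (leq_trans lm); rewrite -ltnS prednK // (leq_ltn_trans _ mn).
Qed.

(** The functions u_l with l < m are constant along the leaf, so its
    tangent vectors are orthogonal to the level gradients of these
    functions. *)
Lemma leaf_orthogonal y (a : 'I_(n - m)) k : B y -> (k < m)%N ->
  inner (G (Phi y)) (row a ('J Phi y)) (e k (Phi y)) = 0.
Proof.
move=> By km; have Ay := PhiA By; have kn := m_pred km.
have kn' : (k < n)%N by exact: ltn_trans km mn.
have T l : (l < m)%N -> dir (row a ('J Phi y)) (u l) (Phi y) = 0.
  move=> lm; have Cl : Ck 1 A (u l) by exact: Ck_le (Cu (m_pred lm)).
  have [_ H] := partial_comp oB CPhi1 a oA Cl By Ay.
  transitivity (partial a (u l \o Phi) y).
    by rewrite H; apply: eq_bigr => i _; rewrite mxE.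
  rewrite -[RHS](partial_cst (u l (Phi y)) a y).
  by apply: (partial_eq_on _ oB) => // x Bx; exact: level.
have := level_gradient kn Ay (fun l lk => T l (ltn_trans lk km)).
rewrite (T k km) mulr0 => /eqP; rewrite mulf_eq0 gt_eqF ?w0 //= => /eqP.
by rewrite innerC ?sG.
Qed.

Lemma derive_leaf (kappa : 'rV[R]_n -> R) (phi : 'rV[R]_(n - m) -> R) v y :
  Ck 1 A kappa -> (forall x, B x -> phi x = kappa (Phi x)) -> B y ->
  'D_v phi y = dir (v *m 'J Phi y) kappa (Phi y).
Proof.
move=> Ck1 phiE By; have Ay := PhiA By.
have -> : 'D_v phi y = 'D_v (kappa \o Phi) y.
  apply: near_eq_derive; have := near_open oB By; apply: filterS => x Bx.
  exact: phiE.
have dc : differentiable (kappa \o Phi) y.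
  apply: differentiable_comp; first exact: (C1_row_differentiable oB CPhi1 By).
  exact: (C1_differentiable oA Ck1 Ay).
rewrite (derive_partial _ dc) /dir.
transitivity (\sum_a \sum_k v 0 a * ('J Phi y a k * partial k kappa (Phi y))).
  apply: eq_bigr => a _; have [_ ->] := partial_comp oB CPhi1 a oA Ck1 By Ay.
  by rewrite mulr_sumr.
rewrite exchange_big; apply: eq_bigr => k _ /=.
by rewrite mxE mulr_suml; apply: eq_bigr => a _; rewrite mulrA.
Qed.

Let uh y : B y -> h y \in unitmx.
Proof.
exact: (induced_metric_unit sG onb PhiA hE immersive leaf_orthogonal).
Qed.

Lemma gradient_level_leaf (phi : 'rV[R]_(n - m) -> R) y : (m < n.-1)%N ->
  (forall x, B x -> phi x = u m (Phi x)) -> B y ->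
  gradient h phi y *m 'J Phi y
  = (w m (Phi y) / w m.+1 (Phi y)) *: e m (Phi y).
Proof.
move=> mn1 phiE By; have Ay := PhiA By.
have mn2 : (m.+1 < n)%N by rewrite -(ltn_predK mn) ltnS.
rewrite (gradient_leaf oA sG onb oB CPhi PhiA hE immersive leaf_orthogonal
  (Ck_le _ (Cu mn1)) phiE By) //.
rewrite (bigD1 (Ordinal mn)) //= big1 ?addr0 => [|i /andP[mi im]]; last first.
  rewrite tangent ?scale0r //.
  by rewrite ltn_neqAle mi andbT eq_sym.
congr (_ *: _); have D := dir_own_level onb tangent level_gradient mn1 Ay.
by rewrite D mulrC mulKf // gt_eqF // w0.
Qed.

(** The intrinsic gradient of u_m is a positive multiple of e_m, because
    the later frame vectors annihilate u_m. *)
Lemma unit_gradient_leaf (phi : 'rV[R]_(n - m) -> R) y : (m < n.-1)%N ->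
  (forall x, B x -> phi x = u m (Phi x)) -> B y ->
  ((vlength (h y) (gradient h phi y))^-1 *: gradient h phi y) *m 'J Phi y
  = e m (Phi y).
Proof.
move=> mn1 phiE By; have Ay := PhiA By.
have mn2 : (m.+1 < n)%N by rewrite -(ltn_predK mn) ltnS.
rewrite -scalemxAl /vlength (inner_pullback hE _ _ By) gradient_level_leaf //.
rewrite innerZl innerZr onb // eqxx mulr1 -expr2 sqrtr_sqr.
have a0 : 0 < w m (Phi y) / w m.+1 (Phi y) by rewrite divr_gt0 // w0.
by rewrite gtr0_norm // scalerA mulVf ?scale1r // gt_eqF.
Qed.

Lemma tangent_component_leaf (a : R) y : B y ->
  (a *: e m (Phi y)) *m pinvmx ('J Phi y) *m 'J Phi y = a *: e m (Phi y).
Proof.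
move=> By; have Ay := PhiA By; rewrite mulmxKpV //.
apply: (leaf_span sG onb PhiA immersive leaf_orthogonal By) => k km.
rewrite innerZl onb // ?(ltn_trans km) // (_ : (m == k) = false) ?mulr0 //.
by apply/negbTE; rewrite neq_ltn km orbT.
Qed.

Let Ce1 : mxCk 1 A (e m). Proof. exact: mxCk_le (Ce mn). Qed.

Lemma inner_nabla_scale (f : 'rV[R]_n -> R) z v v' : Ck 1 A f -> A z ->
  inner (G z) (v *m nabla G (fun x => f x *: e m x) z) v'
  = f z * inner (G z) (v *m nabla G (e m) z) v'
    + dir v f z * inner (G z) (e m z) v'.
Proof.
move=> Cf Az; rewrite (nabla_scale _ Cf Ce1 Az) mulmxDr innerDl -scalemxAr innerZl.
congr (_ + _); rewrite mulmxA (_ : v *m _ = (dir v f z)%:M) ?mul_scalar_mx ?innerZl //.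
apply/rowP => i; rewrite ord1 !mxE eqxx mulr1n; apply: eq_bigr => k _.
by rewrite mxE.
Qed.

(** The product rule for w_m e_m: the derivative of the factor w_m along
    e_m gives the logarithmic derivative in [weighted_mean]. *)
Lemma divergence_weighted (ty : 'rV[R]_(n - m) -> 'rV[R]_(n - m)) y :
  (forall x, B x -> ty x *m 'J Phi x = w m (Phi x) *: e m (Phi x)) -> B y ->
  divergence h ty y = w m (Phi y) * weighted_mean G e w m (Phi y).
Proof.
move=> tyE By; have Ay := PhiA By.
have Cw1 : Ck 1 A (w m) by exact: Ck_le (Cw mn).
have CY : mxCk 1 A (fun z => w m z *: e m z) by exact: (mxCk_scale oA).
rewrite (divergence_leaf oA sG uG CG onb oB CPhi PhiA hE immersive
  leaf_orthogonal CY tyE By).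
under eq_bigr => j _ do rewrite (inner_nabla_scale _ _ Cw1 Ay).
rewrite (bigD1 (Ordinal mn)) //= onb // eqxx mulr1.
rewrite -/(conn G e m m m (Phi y)).
rewrite (conn_diag oA sG uG CG Ce onb (Ordinal mn) (Ordinal mn) Ay) mulr0 add0r.
rewrite /weighted_mean mulrDr; congr (_ + _).
  rewrite (dir_ln _ (fun z Az => w0 mn Az) Cw1 Ay) mulrA mulfV ?mul1r //.
  by rewrite gt_eqF // w0.
rewrite /mean_curvature mulr_sumr; apply: eq_big => [j|j /andP[mj jm]].
  by rewrite [RHS]ltn_neqAle andbC; congr (_ && _); rewrite eq_sym.
rewrite onb // (_ : (m == j :> nat) = false) ?mulr0 ?addr0 //.
by apply/negbTE; rewrite eq_sym.
Qed.

Lemma covariant_sqnorm_unit (ty : 'rV[R]_(n - m) -> 'rV[R]_(n - m)) y :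
  (forall x, B x -> ty x *m 'J Phi x = e m (Phi x)) -> B y ->
  covariant_sqnorm h ty y
  = \sum_(i < n | (m <= i)%N) \sum_(j < n | (m <= j)%N) conn G e i m j (Phi y) ^+ 2.
Proof.
move=> tyE By.
exact: (covariant_sqnorm_leaf oA sG uG CG onb oB CPhi PhiA hE immersive
  leaf_orthogonal Ce1 tyE By).
Qed.

Section Curve.
Hypothesis last : m.+1 = n.
Variables (f : 'rV[R]_n -> R) (phi : 'rV[R]_(n - m) -> R).
Hypotheses (Cf : Ck 2 A f) (phiE : forall x, B x -> phi x = f (Phi x)).

Let sum_last (V : zmodType) (X : nat -> V) :
  \sum_(i < n | (m <= i)%N) X i = X m.
Proof.
rewrite (bigD1 (Ordinal mn)) //= big1 ?addr0 // => i /andP[mi /eqP im].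
by case: im; apply: val_inj => /=; apply/eqP; rewrite eqn_leq mi -ltnS last ltn_ord.
Qed.

Let gradE y : B y ->
  gradient h phi y *m 'J Phi y = dir (e m (Phi y)) f (Phi y) *: e m (Phi y).
Proof.
move=> By; rewrite (gradient_leaf oA sG onb oB CPhi PhiA hE immersive
  leaf_orthogonal (Ck_le _ Cf) phiE By) //.
exact: (sum_last (fun i => dir (e i (Phi y)) f (Phi y) *: e i (Phi y))).
Qed.

(** The last leaf is a curve with unit tangent e_m, and the Laplacian on
    it is the second derivative by arc length, because nabla_{e_m} e_m has
    no tangential part. *)
Lemma laplacian_curve y : B y ->
  laplacian h phi y
  = dir (e m (Phi y)) (fun z => dir (e m z) f z) (Phi y).
Proof.
move=> By; have Ay := PhiA By.
have Cd : Ck 1 A (fun z => dir (e m z) f z) by exact: (Ck_dir oA).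
have CY : mxCk 1 A (fun z => dir (e m z) f z *: e m z) by exact: (mxCk_scale oA).
rewrite /laplacian (divergence_leaf oA sG uG CG onb oB CPhi PhiA hE immersive
  leaf_orthogonal CY gradE By).
rewrite (sum_last (fun j => inner _ (e j (Phi y) *m _) (e j (Phi y)))).
rewrite (inner_nabla_scale _ _ Cd Ay) onb // eqxx mulr1 -/(conn G e m m m (Phi y)).
by rewrite (conn_diag oA sG uG CG Ce onb (Ordinal mn) (Ordinal mn) Ay) mulr0 add0r.
Qed.

Lemma gradient_sqnorm_curve y : B y ->
  vlength (h y) (gradient h phi y) ^+ 2 = dir (e m (Phi y)) f (Phi y) ^+ 2.
Proof.
move=> By; have Ay := PhiA By.
have E : inner (h y) (gradient h phi y) (gradient h phi y)
    = dir (e m (Phi y)) f (Phi y) ^+ 2.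
  by rewrite (inner_pullback hE _ _ By) gradE // innerZl innerZr onb // eqxx mulr1 expr2.
by rewrite /vlength E sqr_sqrtr // sqr_ge0.
Qed.

End Curve.

End LeafOfFlag.

(** * The identity on the manifold *)

Section Charts.
Variables (R : realType) (M : topologicalType) (d : nat).
Implicit Types (S V : set M) (s : chart R M d).

(** The image is the preimage of V under the inverse of the chart, which
    is continuous. *)
Lemma chart_image_open S V s : is_chart S s -> open V ->
  open (co s @` (dom s `&` V)).
Proof.
move=> [_ os _ cpar parK] oV; rewrite openE => _ [q [sq Vq] <-].
have im : (co s @` dom s) (co s q) by exists q.
have n1 := near_open os im.
have n2 : \forall y \near co s q, V (par s y).
  apply: (cpar _ im); rewrite parK //; exact: open_nbhs_nbhs.
apply: filterS2 n1 n2 => _ [q' sq' <-]; rewrite parK // => Vq'.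
by exists q'.
Qed.

Lemma chart_dom_open s : is_chart setT s -> open (dom s).
Proof. by move=> [[W oW ->]] _ _ _ _; rewrite setTI. Qed.

End Charts.

Theorem theorem2p5 (R : realType) (n : nat) (n_ge2 : (2 <= n)%N)
    (M : smoothManifold R n) (g : riemannianMetric M) (p : M)
    (u : nat -> M -> R) (U : set M) (Z : nat -> vectorField U)
    (* U is the neighbourhood of p meant by "near p";
       c is a chart of M at p; s m is a chart at p of the level set Sigma_m
       through p, a submanifold of dimension n - m *)
    (c : chart R M n) (s : forall m : nat, chart R M (n - m)) :
  (forall i, (i < n.-1)%N -> CkOn 3 setT (u i)) ->
  atlas c -> dom c p ->
  (exists v : 'I_n.-1 -> 'rV[R]_n,
     wedge (fun i => differential c (u i) p) v != 0) ->
  open U -> U p ->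
  (forall m c' q, (m < n)%N -> atlas c' -> dom c' q -> U q ->
     Z m c' q != 0) ->
  (forall m c' q, (m < n.-1)%N -> atlas c' -> dom c' q -> U q ->
     is_level_gradient g u c' m (u m) q
       ((field_length g c' (Z m.+1) q)^-1 *: Z m c' q)) ->
  (forall m, (m < n)%N -> submanifold_chart 3 (level u m p) (s m)) ->
  (forall m, (m < n)%N -> dom (s m) p) ->
  let G := g c \o par c in
  let x := co c p in
  let h := fun m => induced_metric g c (s m) in
  let y := fun m => co (s m) p in
  let len := fun m => field_length g c (Z m) in
  let divZ := fun m => divergence (h m) (tangent_comp c (s m) (Z m)) in
  let nu := fun m => unit_gradient g c (s m) (u m) in
  let loglen0 := (fun q => ln (len 0%N q)) \o par c in
  let loglenS := (fun q => ln (len n.-1 q)) \o par (s n.-1) in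
  (forall m, (m < n.-1)%N -> divZ m (y m) = 0) ->
  2 * (len 0%N p)^-1 * laplacian G (len 0%N \o par c) x
  - 2 * laplacian (h n.-1) loglenS (y n.-1)
  - 2 * \sum_(0 <= m < n.-1)
          (len m p)^-1 * 'D_(nu m (y m)) (divZ m) (y m)
  = scalar_curvature G x
    + \sum_(0 <= m < n.-1) covariant_sqnorm (h m) (nu m) (y m)
    + vlength (h n.-1 (y n.-1)) (gradient (h n.-1) loglenS (y n.-1)) ^+ 2
    + vlength (G x) (gradient G loglen0 x) ^+ 2.
Proof.
move=> Cu ac cp _ oU Up Z0 Zgrad Schart Sp G x h y len divZ nu loglen0 loglenS div0.
have n0 : (0 < n)%N by exact: ltnW.
have chc := atlas_chart ac.
have parK q : dom c q -> par c (co c q) = q by case: chc => _ _ _ _; exact.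
(* The data are read in the coordinates of c: Zc m and uu m represent Z_m
   and u_m, and w m is the length of Z_m. *)
pose A0 := co c @` (dom c `&` U).
have oA0 : open A0 by exact: chart_image_open chc oU.
have A0x : A0 x by exists p.
have A0P z : A0 z -> [/\ dom c (par c z), U (par c z) & co c (par c z) = z].
  by move=> [q [cq Uq] <-]; rewrite parK.
pose Zc m : 'rV[R]_n -> 'rV[R]_n := Z m c \o par c.
pose uu m : 'rV[R]_n -> R := u m \o par c.
pose w m z := vlength (G z) (Zc m z).
have sG z : A0 z -> (G z)^T = G z.
  by move=> /A0P[cz _ _]; exact: gram_sym.
have pG z v : A0 z -> v != 0 -> 0 < inner (G z) v v.
  by move=> /A0P[cz _ _] v0; exact: gram_pos.
have A0dom : A0 `<=` co c @` dom c by move=> _ [q [cq _] <-]; exists q.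
have CG0 : mxCk 2 A0 G.
  move=> a b; apply: (Ck_coord a b oA0).
  exact: Ck_subset A0dom (gram_smooth g ac 2).
have CZ m : (m < n)%N -> mxCk 2 A0 (Zc m).
  move=> mn a b; apply: (Ck_coord a b oA0).
  exact: (components_smooth (Z m) ac 2).
have Zc0 m z : (m < n)%N -> A0 z -> Zc m z != 0.
  by move=> mn /A0P[cz Uz _]; exact: Z0.
have Cuu m : (m < n.-1)%N -> Ck 2 A0 (uu m).
  move=> mn; apply: Ck_leS; apply: Ck_subset (Cu m mn c ac).
  by move=> _ [q [cq _] <-]; exists q.
have pairE m q v : dom c q -> pairing (differential c (u m) q) v = dir v (uu m) (co c q).
  move=> cq; rewrite /pairing mxE; apply: eq_bigr => i _.
  by rewrite [X in _ * X]mxE [X in _ * X]mxE.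
have w0 m z : (m < n)%N -> A0 z -> 0 < w m z.
  by move=> mn Az; exact: (length_gt0 pG Zc0).
have scaleZ m z : (m < n.-1)%N -> A0 z -> w m.+1 z *: ((w m.+1 z)^-1 *: Zc m z) = Zc m z.
  move=> mn Az; rewrite scalerA mulfV ?scale1r // gt_eqF // w0 //.
  by rewrite -(prednK n0) ltnS.
have dirZ (a : R) v f z : dir (a *: v) f z = a * dir v f z :> R.
  rewrite /dir mulr_sumr; apply: eq_bigr => i _.
  by rewrite mxE mulrA.
have Ztan m l z : (l < m)%N -> (m < n.-1)%N -> A0 z -> dir (Zc m z) (uu l) z = 0.
  move=> lm mn Az; have [cz Uz zE] := A0P _ Az.
  have [T _] := Zgrad m c _ mn ac cz Uz.
  have := T l lm; rewrite pairE // zE => T'.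
  by rewrite -(scaleZ _ _ mn Az) dirZ T' mulr0.
have Zgr m z v : (m < n.-1)%N -> A0 z ->
    (forall l, (l < m)%N -> dir v (uu l) z = 0) ->
    inner (G z) (Zc m z) v = w m.+1 z * dir v (uu m) z.
  move=> mn Az vt; have [cz Uz zE] := A0P _ Az.
  have [_ T] := Zgrad m c _ mn ac cz Uz.
  rewrite -{1}(scaleZ _ _ mn Az) innerZl; congr (_ * _).
  have := T v; rewrite pairE // zE; apply.
  by move=> l lm; rewrite pairE // zE vt.
have [A [e [[oA Ax AA0] [Ce onb eE tan grad]]]] :=
  level_frame_exists oA0 sG pG CG0 n0 CZ Zc0 Ztan Zgr A0x.
have {}sG z : A z -> (G z)^T = G z by move=> /AA0; exact: sG.
have uG z : A z -> G z \in unitmx by move=> /AA0; exact: (pos_unitmx pG).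
have CG : mxCk 2 A G by move=> a b; exact: Ck_subset AA0 (CG0 a b).
have Cw m : (m < n)%N -> Ck 2 A (w m).
  by move=> mn; exact: Ck_subset AA0 (length_Ck oA0 pG CG0 CZ Zc0 mn).
have {}w0 m z : (m < n)%N -> A z -> 0 < w m z by move=> mn /AA0; exact: w0.
have {}Cuu m : (m < n.-1)%N -> Ck 2 A (uu m).
  by move=> mn; apply: Ck_subset AA0 _; exact: Cuu.
(* The leaf Sigma_m through p is an immersion Phi m into these
   coordinates, restricted to the part B m of its chart that is mapped to
   the domain of the frame. *)
pose Phi m : 'rV[R]_(n - m) -> 'rV[R]_n := co c \o par (s m).
pose D m := co (s m) @` (dom (s m) `&` dom c).
pose B m := D m `&` [set z | A (Phi m z)].
have odc : open (dom c) by exact: chart_dom_open chc.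
have CPhi3 m : (m < n)%N -> Ck 3 (D m) (Phi m).
  by move=> mn; have [_ H] := Schart m mn; have [] := H c ac.
have sK m q : (m < n)%N -> dom (s m) q -> par (s m) (co (s m) q) = q.
  by move=> mn sq; have [[_ _ _ _ H] _] := Schart m mn; exact: H.
have oB m : (m < n)%N -> open (B m).
  move=> mn; have [chs _] := Schart m mn.
  have oD : open (D m) by exact: chart_image_open chs odc.
  rewrite openE => z [Dz Az]; apply: filterI; first exact: near_open.
  apply: (Ck_continuous (CPhi3 m mn) Dz); exact: near_open.
have CPhi m : (m < n)%N -> Ck 2 (B m) (Phi m).
  move=> mn; apply: Ck_leS; apply: Ck_subset (CPhi3 m mn).
  by move=> z [].
have PhiA m z : B m z -> A (Phi m z) by case.
have parPhi m z : (m < n)%N -> B m z -> par c (Phi m z) = par (s m) z.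
  by move=> mn [[q [sq cq] <-] _]; rewrite /Phi /= sK // parK.
have By m : (m < n)%N -> B m (y m).
  move=> mn; split; first by exists p => //; split=> //; exact: Sp.
  by rewrite /= /Phi /= /y (sK m p mn (Sp m mn)).
have Phiy m : (m < n)%N -> Phi m (y m) = x.
  by move=> mn; rewrite /Phi /= /y (sK m p mn (Sp m mn)).
have hE m z : (m < n)%N -> B m z ->
    h m z = 'J (Phi m) z *m G (Phi m z) *m ('J (Phi m) z)^T.
  by move=> mn Bz; rewrite /h /induced_metric /frame /G /= parPhi.
have imm m z : (m < n)%N -> B m z -> row_free ('J (Phi m) z).
  move=> mn [[q [sq cq] <-] _]; have [_ H] := Schart m mn.
  by have [_] := H c ac; apply.
have lev m l z z' : (m < n)%N -> (l < m)%N -> B m z -> B m z' ->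
    uu l (Phi m z) = uu l (Phi m z').
  move=> mn lm Bz Bz'; rewrite /uu /= !parPhi //.
  have [[[W _ domE] _ _ _ _] _] := Schart m mn.
  have L z1 : B m z1 -> u l (par (s m) z1) = u l p.
    move=> [[q [sq cq] <-] _]; rewrite sK //.
    by move: sq; rewrite domE => -[lq _]; exact: lq.
  by rewrite !L.
have lenE m z : (m < n)%N -> B m z -> len m (par (s m) z) = w m (Phi m z).
  by move=> mn Bz; rewrite -parPhi.
have lenp m : len m p = w m x by rewrite /w /G /Zc /= /x parK.
have pred_lt m : (m < n.-1)%N -> (m < n)%N.
  by move=> mn; rewrite (leq_trans mn) ?leq_pred.
have hEm m mn z (Bz : B m z) := hE m z mn Bz.
have immm m mn z (Bz : B m z) := imm m z mn Bz.
have levm m mn l z z' lm (Bz : B m z) (Bz' : B m z') := lev m l z z' mn lm Bz Bz'.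
have nuE m z : (m < n.-1)%N -> B m z -> nu m z *m 'J (Phi m) z = e m (Phi m z).
  move=> mn Bz; have mn' := pred_lt _ mn.
  apply: (unit_gradient_leaf oA sG onb Cuu w0 tan grad mn' (oB _ mn')
    (CPhi _ mn') (PhiA m) (hEm _ mn') (immm _ mn') (levm _ mn') mn) => // z1 Bz1.
  by rewrite /uu /= parPhi.
have tangE m z : (m < n.-1)%N -> B m z ->
    tangent_comp c (s m) (Z m) z *m 'J (Phi m) z = w m (Phi m z) *: e m (Phi m z).
  move=> mn Bz; have mn' := pred_lt _ mn.
  have ZE : Z m c (par (s m) z) = w m (Phi m z) *: e m (Phi m z).
    rewrite eE // scalerA mulfV ?scale1r; first by rewrite /Zc /= parPhi.
    by rewrite gt_eqF // w0 //; exact: PhiA.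
  rewrite /tangent_comp /frame ZE.
  exact: (tangent_component_leaf oA sG onb Cuu w0 grad mn' (oB _ mn')
    (CPhi _ mn') (PhiA m) (immm _ mn') (levm _ mn') _ Bz).
pose K := weighted_mean G e w.
have divE m z : (m < n.-1)%N -> B m z -> divZ m z = w m (Phi m z) * K m (Phi m z).
  move=> mn Bz; have mn' := pred_lt _ mn.
  apply: (divergence_weighted oA sG uG CG Ce onb Cuu Cw w0 grad mn' (oB _ mn')
    (CPhi _ mn') (PhiA m) (hEm _ mn') (immm _ mn') (levm _ mn')) Bz => z1 Bz1.
  exact: tangE.
have K0 m : (m < n.-1)%N -> K m x = 0.
  move=> mn; have mn' := pred_lt _ mn; have := div0 m mn.
  rewrite (divE _ _ mn (By _ mn')) (Phiy _ mn') => /eqP.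
  by rewrite mulf_eq0 gt_eqF ?w0 //= => /eqP.
have derE m : (m < n.-1)%N ->
    (len m p)^-1 * 'D_(nu m (y m)) (divZ m) (y m) = dir (e m x) (K m) x.
  move=> mn; have mn' := pred_lt _ mn.
  have CK : Ck 1 A (K m) by exact: (weighted_mean_C1 oA uG CG Ce Cw w0 mn').
  have Cw1 : Ck 1 A (w m) by exact: Ck_leS (Cw m mn').
  rewrite (derive_leaf oA (oB _ mn') (CPhi _ mn') (PhiA m) (nu m (y m))
    (CkM oA Cw1 CK) (fun z Bz => divE m z mn Bz) (By _ mn')).
  rewrite (nuE _ _ mn (By _ mn')) (Phiy _ mn') (dirM _ Cw1 CK Ax) K0 // mulr0 add0r lenp.
  by rewrite mulKf // gt_eqF // w0.
have sqE m : (m < n.-1)%N -> covariant_sqnorm (h m) (nu m) (y m)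
    = \sum_(i < n | (m <= i)%N) \sum_(j < n | (m <= j)%N) conn G e i m j x ^+ 2.
  move=> mn; have mn' := pred_lt _ mn.
  rewrite (covariant_sqnorm_unit oA sG uG CG Ce onb Cuu w0 grad mn' (oB _ mn')
    (CPhi _ mn') (PhiA m) (hEm _ mn') (immm _ mn') (levm _ mn')
    (fun z Bz => nuE m z mn Bz) (By _ mn')).
  by rewrite Phiy.
have nl : (n.-1 < n)%N by rewrite prednK.
have nlS : n.-1.+1 = n by rewrite prednK.
pose f m z : R := ln (w m z).
have Cf m : (m < n)%N -> Ck 2 A (f m).
  by move=> mn; apply: (Ck_ln oA) => [z|]; [exact: w0|exact: Cw].
have logE z : B n.-1 z -> loglenS z = f n.-1 (Phi n.-1 z).
  by move=> Bz; rewrite /loglenS /= lenE.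
have lapE : laplacian (h n.-1) loglenS (y n.-1)
    = dir (e n.-1 x) (fun z => dir (e n.-1 z) (f n.-1) z) x.
  rewrite (laplacian_curve oA sG uG CG Ce onb Cuu w0 grad nl (oB _ nl)
    (CPhi _ nl) (PhiA _) (hEm _ nl) (immm _ nl) (levm _ nl) nlS (Cf _ nl) logE (By _ nl)).
  by rewrite Phiy.
have gradE : vlength (h n.-1 (y n.-1)) (gradient (h n.-1) loglenS (y n.-1)) ^+ 2
    = dir (e n.-1 x) (f n.-1) x ^+ 2.
  rewrite (gradient_sqnorm_curve oA sG onb Cuu w0 grad nl (oB _ nl)
    (CPhi _ nl) (PhiA _) (hEm _ nl) (immm _ nl) (levm _ nl) nlS (Cf _ nl) logE (By _ nl)).
  by rewrite Phiy.
have grad0E : vlength (G x) (gradient G loglen0 x) ^+ 2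
    = \sum_(i < n) dir (e i x) (f 0%N) x ^+ 2.
  have E : inner (G x) (gradient G loglen0 x) (gradient G loglen0 x)
      = \sum_(i < n) dir (e i x) (f 0%N) x ^+ 2.
    rewrite (gradient_frame sG uG onb _ Ax).
    exact: (sqnorm_frame onb (fun i => dir (e i x) (f 0%N) x) Ax).
  rewrite /vlength E sqr_sqrtr // sumr_ge0 // => i _.
  exact: sqr_ge0.
rewrite lapE gradE grad0E lenp !big_mkord.
have -> : \sum_(m < n.-1) (len m p)^-1 * 'D_(nu m (y m)) (divZ m) (y m)
    = \sum_(m < n.-1) dir (e m x) (K m) x.
  by apply: eq_bigr => m _; exact: derE.
have -> : \sum_(m < n.-1) covariant_sqnorm (h m) (nu m) (y m)
    = \sum_(m < n.-1) \sum_(i < n | (m <= i)%N)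
        \sum_(j < n | (m <= j)%N) conn G e i m j x ^+ 2.
  by apply: eq_bigr => m _; exact: sqE.
have -> : \sum_(m < n.-1) \sum_(i < n | (m <= i)%N)
    \sum_(j < n | (m <= j)%N) conn G e i m j x ^+ 2
  = \sum_(m < n) \sum_(i < n | (m <= i)%N)
    \sum_(j < n | (m <= j)%N) conn G e i m j x ^+ 2.
  (* For m = n-1 only the index j = n-1 remains, and the coefficient
     vanishes by antisymmetry. *)
  pose T (m : nat) := \sum_(i < n | (m <= i)%N) \sum_(j < n | (m <= j)%N) conn G e i m j x ^+ 2.
  rewrite -!(big_mkord xpredT T) -[in RHS]nlS big_nat_recr //= /T.
  rewrite [X in _ + X]big1 ?addr0 // => i _; apply: big1 => j lj.
  have -> : j = Ordinal nl.
    apply: val_inj => /=; apply/eqP; rewrite eqn_leq lj andbT.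
    by rewrite -ltnS nlS ltn_ord.
  by rewrite (conn_diag oA sG uG CG Ce onb i (Ordinal nl) Ax) expr0n.
exact: (frame_identity oA sG uG CG Ce onb Cuu Cw w0 tan grad Ax n0 K0).
Qed.
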